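(* For a knot projection $P$, let $c(P)$ denote the number of double points of $P$, and let $C(P)=0$ if $c(P)=0$ and $C(P)=1$ if $c(P)\neq 0$. Then $C(P)$ is invariant under weak RII, weak RIII, and strong RIII; that is, if a knot projection $P'$ is obtained from $P$ by a single move of one of these types (in either direction), then $C(P)=C(P')$.
   Context: A knot projection is the image of a generic immersion from a circle into the $2$-sphere $S^2$; in particular, every self-intersection is a transverse double point (called a double point). Knot projections are considered up to sphere isotopy (a smooth family of homeomorphisms $h_t$ of $S^2$, $t\in[0,1]$, with $h_0=\mathrm{id}$ and $h_1(P)=P'$). An $n$-gon of a knot projection $P$ is a connected component of $S^2\setminus P$ whose boundary consists of $n$ edges (arcs of $P$ between consecutive double points, counted with multiplicity). Orient $P$ arbitrarily. An $n$-gon is coherent if the orientations induced on its $n$ edges are coherent, i.e. together give an orientation of the boundary of the $n$-gon; otherwise it is incoherent. This does not depend on the choice of orientation of $P$. The moves are local replacements inside a closed disk $D\subset S^2$, leaving $P\setminus D$ and the endpoints on $\partial D$ fixed; each may be applied in either direction. \begin{itemize} \item Weak RII: replaces two disjoint simple arcs in $D$ by two simple arcs, with the same respective endpoints, crossing each other transversally at exactly two points (so that a $2$-gon inside $D$ is created), or vice versa, where the created or deleted $2$-gon is incoherent. \item RIII: $P\cap D$ consists of three simple arcs, any two of which cross transversally at exactly one point, the three crossings being distinct and bounding a $3$-gon in $D$; the move passes one arc across the crossing of the other two, yielding the other such configuration with the same respective endpoints. It is a strong RIII if the $3$-gon in $D$ is coherent, and a weak RIII if it is incoherent (the type of the $3$-gon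 is the same before and after the move). \end{itemize} *)

(* Defs.v *)
From HB Require Import structures.
From mathcomp Require Export all_boot all_order all_algebra finmap.
From mathcomp Require Export all_classical all_reals all_analysis.
Export numFieldNormedType.Exports.
Export Order.TTheory GRing.Theory Num.Theory.

#[export] Set Implicit Arguments.
#[export] Unset Strict Implicit.
#[export] Unset Printing Implicit Defensive.

Open Scope classical_set_scope.
Open Scope ring_scope.

(* C^infinity: every iterated directional derivative exists and is
   continuous. *)
Definition smooth (R : realType) (V W : normedModType R) (F : V -> W) : Prop :=
  forall vs : seq V,
    let G := foldr (fun v H => 'D_v H) F vs in
    continuous G /\ forall p v, derivable G p v.

Section Plane_and_sphere.
Context {R : realType}.

Definition sphere : set 'rV[R]_3 := [set x | \sum_i x 0 i ^+ 2 = 1].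

Definition cdisk : set (R * R) := [set z | z.1 ^+ 2 + z.2 ^+ 2 <= 1].
Definition odisk : set (R * R) := [set z | z.1 ^+ 2 + z.2 ^+ 2 < 1].
Definition ucircle : set (R * R) := [set z | z.1 ^+ 2 + z.2 ^+ 2 = 1].

(* The point at fraction s of a full turn on the unit circle. *)
Definition turn (s : R) : R * R := (cos (s * pi *+ 2), sin (s * pi *+ 2)).

End Plane_and_sphere.

Section Knot_projections.
Context {R : realType}.
Implicit Types (f : R -> 'rV[R]_3) (P : set 'rV[R]_3).

(* The circle is R / Z: a map from the circle is a 1-periodic map on R, and
   parameters s, t are the same point of the circle iff s - t is an integer. *)
Definition double_points f : set 'rV[R]_3 :=
  [set x | exists s t, [/\ s - t \isn't a Num.int, f s = x & f t = x]].

(* The tangent vectors of a curve on the sphere lie in the tangent plane of the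
   sphere, so two branches are transverse in the sphere iff their velocities are
   linearly independent. *)
Record generic_immersion f : Prop := GenericImmersion {
  gi_smooth : @smooth R R^o 'rV[R]_3 f ;
  gi_periodic : forall t, f (t + 1) = f t ;
  gi_sphere : forall t, sphere (f t) ;
  gi_immersion : forall t, derive1 f t != 0 ;
  gi_double : forall r s t, f r = f s -> f s = f t ->
    [|| r - s \is a Num.int, s - t \is a Num.int | r - t \is a Num.int] ;
  gi_transverse : forall s t, f s = f t -> s - t \isn't a Num.int ->
    row_free (col_mx (derive1 f s) (derive1 f t)) }.

Definition parametrizes f P : Prop := generic_immersion f /\ range f = P.

Definition knot_projection P : Prop := exists f, parametrizes f P.

(* All the parametrizations of P have the same set of double points, and it is
   finite (otherwise fset_set would return the empty set). *)
Definition crossings P : set 'rV[R]_3 :=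
  \bigcup_(f in [set f | parametrizes f P]) double_points f.

Definition c P : nat := #|` fset_set (crossings P)|.

Definition C P : nat := if c P == 0%N then 0%N else 1%N.

(* Smoothness on the submanifold [0, 1] * S^2 of R * R^3 means having a smooth
   extension to R * R^3.  Since the sphere is compact Hausdorff, a continuous
   bijection of it is a homeomorphism. *)
Definition sphere_isotopic P P' : Prop :=
  exists H : R^o * 'rV[R]_3 -> 'rV[R]_3,
  [/\ smooth H,
      forall t, 0 <= t <= 1 -> set_bij sphere sphere (fun x => H (t, x)),
      forall x, sphere x -> H (0, x) = x &
      [set H (1, x) | x in P] = P'].

(* ]s, t[ parametrizes an open edge, and the direction of increasing parameter
   is the orientation of the edge induced by f. *)
Definition edge f (s t : R) : Prop :=
  [/\ s < t, double_points f (f s), double_points f (f t) &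
      forall r, s < r < t -> ~ double_points f (f r)].

(* The region U is an n-gon, presented as the image of an open disk under a map
   phi that wraps the boundary circle, divided into n equal sides, around the
   boundary of U.  The i-th side follows an edge from parameter x i to parameter
   y i, along the orientation of f if x i < y i and against it if y i < x i; the
   affine speed is no restriction, phi being reparametrizable near the boundary.
   An edge occurring twice on the boundary is followed by two sides. *)
Definition ngon f (n : nat) (U : set 'rV[R]_3) (phi : R * R -> 'rV[R]_3)
    (x y : 'I_n -> R) : Prop :=
  [/\ (0 < n)%N,
      exists2 p, (sphere `\` range f) p &
        U = connected_component (sphere `\` range f) p,
      {within cdisk, continuous phi},
      set_bij odisk U phi &
      forall i : 'I_n,
        (edge f (x i) (y i) \/ edge f (y i) (x i)) /\
        forall u, 0 <= u <= 1 ->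
          phi (turn ((i%:R + u) / n%:R)) = f ((1 - u) * x i + u * y i)].

(* The orientations of the edges agree with one of the two directions in which
   the boundary is run through. *)
Definition coherent (n : nat) (x y : 'I_n -> R) : Prop :=
  (forall i, x i < y i) \/ (forall i, y i < x i).

Definition closed_disk (psi : R * R -> 'rV[R]_3) : Prop :=
  [/\ {within cdisk, continuous psi}, set_inj cdisk psi &
      psi @` cdisk `<=` sphere].

Definition arc f (n : nat) (a b : 'I_n -> R) (i : 'I_n) : set 'rV[R]_3 :=
  f @` `[a i, b i].

(* The part of the curve f in the disk D = psi(cdisk) consists of the n simple
   arcs parametrized by the (disjoint in R / Z) intervals [a i, b i], with end
   points on the boundary of D and all other points in its interior. *)
Definition simple_arcs f (psi : R * R -> 'rV[R]_3) (n : nat)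
    (a b : 'I_n -> R) : Prop :=
  [/\ forall i, a i < b i,
      forall i j s t, s \in `[a i, b i] -> t \in `[a j, b j] ->
        s - t \is a Num.int -> i = j /\ s = t,
      forall t, (psi @` cdisk) (f t) <->
        exists i (k : int), t + k%:~R \in `[a i, b i],
      forall i, set_inj `[a i, b i] f &
      forall i, [/\ (psi @` ucircle) (f (a i)), (psi @` ucircle) (f (b i)) &
        forall t, a i < t < b i -> (psi @` odisk) (f t)]].

(* f' is obtained from f by replacing n simple arcs in the disk by n simple arcs
   with the same respective end points.  Outside the disk the two curves are the
   same, hence can be parametrized by the same map there. *)
Definition local_replacement f f' (psi : R * R -> 'rV[R]_3) (n : nat)
    (a b : 'I_n -> R) : Prop :=
  [/\ closed_disk psi, simple_arcs f psi a b, simple_arcs f' psi a b,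
      forall t, ~ (psi @` cdisk) (f t) -> f' t = f t &
      forall i, f' (a i) = f (a i) /\ f' (b i) = f (b i)].

(* Distinct arcs cross pairwise in exactly m points.  For generic immersions the
   crossings are transverse and no three branches meet. *)
Definition cross_pairwise f (n : nat) (a b : 'I_n -> R) (m : nat) : Prop :=
  forall i j, i != j -> (arc f a b i `&` arc f a b j #= `I_m)%card.

(* The vertices x i, y i and the side i run through the i-th arc. *)
Definition ngon_in_disk f (psi : R * R -> 'rV[R]_3) (n : nat)
    (a b x y : 'I_n -> R) : Prop :=
  exists U phi, [/\ ngon f U phi x y, U `<=` psi @` cdisk &
    forall i, x i \in `[a i, b i] /\ y i \in `[a i, b i]].

Definition weak_RII_creation P P' : Prop :=
  exists f f' psi (a b : 'I_2 -> R),
  [/\ parametrizes f P, parametrizes f' P', local_replacement f f' psi a b,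
      cross_pairwise f a b 0 &
      cross_pairwise f' a b 2 /\
      exists x y, ngon_in_disk f' psi a b x y /\ ~ coherent x y].

Definition weak_RII P P' : Prop :=
  weak_RII_creation P P' \/ weak_RII_creation P' P.

(* The two configurations of three pairwise crossing arcs with given end points
   differ by the order of the two crossings on each arc. *)
Definition opposite_configurations f f' (a b : 'I_3 -> R) : Prop :=
  forall (i j k : 'I_3) s t s' t', i != j -> i != k -> j != k ->
    [/\ s \in `[a i, b i], t \in `[a i, b i],
        s' \in `[a i, b i] & t' \in `[a i, b i]] ->
    [/\ arc f a b j (f s), arc f a b k (f t),
        arc f' a b j (f' s') & arc f' a b k (f' t')] ->
    (s < t) = (t' < s').

Definition RIII_with (type : ('I_3 -> R) -> ('I_3 -> R) -> Prop) P P' : Prop :=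
  exists f f' psi (a b : 'I_3 -> R),
  [/\ parametrizes f P, parametrizes f' P', local_replacement f f' psi a b,
      cross_pairwise f a b 1 /\ cross_pairwise f' a b 1 &
      [/\ opposite_configurations f f' a b,
          exists x y, ngon_in_disk f psi a b x y /\ type x y &
          exists x y, ngon_in_disk f' psi a b x y /\ type x y]].

Definition strong_RIII P P' : Prop :=
  RIII_with (@coherent 3) P P' \/ RIII_with (@coherent 3) P' P.

Definition weak_RIII P P' : Prop :=
  RIII_with (fun x y => ~ coherent x y) P P' \/
  RIII_with (fun x y => ~ coherent x y) P' P.

(* Moves are applied to projections up to sphere isotopy. *)
Definition up_to_isotopy (move : set 'rV[R]_3 -> set 'rV[R]_3 -> Prop) P P' :
    Prop :=
  exists Q Q', [/\ sphere_isotopic P Q, move Q Q' & sphere_isotopic Q' P'].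

End Knot_projections.

(* Main.v *)
Require Import Defs.
From mathcomp Require Import ring lra.

(* A knot projection has a double point iff two points can be removed from it
   without disconnecting it, so isotopies preserve C; and both sides of RIII have
   double points. If weak RII created an incoherent bigon from a simple closed
   curve, the result would have exactly two double points, visited in the order
   A B A B. No such curve exists on the sphere, by Gauss' parity argument: after
   stereographic projection, the two loops based at A would touch at A and cross
   transversally at B only. The parity is obtained as the winding number around 0
   of the difference of the two loops on the boundary of the parameter square,
   counted modulo 2 by crossings of a ray. *)

(** * Crossings of a ray in the plane *)

Section RayCrossings.
Context {R : realType}.
Implicit Types (u v z : R * R) (k : R -> R * R).

(** Incoherence is what yields the order A B A B: one side of the bigon is followed along the curve
    and the other against it, so both strands run from the same vertex to the other one. A coherent
    bigon gives A B B A, an order that does occur. The difference of the two loops vanishes at all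
    four corners of the parameter square (the touching at A) and at the crossing B, so the parity on
    its boundary is not defined as it stands. Cutting the square at the parameters of B leaves four
    rectangles, each with zeros only at two opposite corners, one for A and one for B. Near such a
    corner the values stay in an open half plane, because the two tangent directions involved are
    not opposite; the corner then contributes only an angle between tangents. Half planes are
    therefore the common language of the planar part: parity is additive inside one, and tangency is
    expressed through them. *)

Definition dot2 u v : R := u.1 * v.1 + u.2 * v.2.

Definition det2 u v : R := u.1 * v.2 - u.2 * v.1.

(* The lower half plane, with one of the two halves of the axis added so that
   exactly one of u and - u is below when u != 0. *)
Definition below u := (u.2 < 0) || ((u.2 == 0) && (u.1 < 0)).

(* Parity of the crossings of the ray {(x, 0) | x >= 0} by the segment from u to
   v, meaningful when the segment avoids 0. *)
Definition chi u v := (below u (+) below v) && ((0 < det2 u v) == below u).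

Lemma belowP u : below u -> u.2 < 0 \/ u.2 = 0 /\ u.1 < 0.
Proof. by case/orP=> [|/andP[/eqP]]; [left|right]. Qed.

Lemma belowPn u : ~~ below u -> 0 < u.2 \/ u.2 = 0 /\ 0 <= u.1.
Proof.
rewrite /below negb_or -leNgt negb_and -leNgt => /andP[].
by rewrite le_eqVlt eq_sym => /orP[/eqP-> | ]; [rewrite eqxx; right | left].
Qed.

Lemma below_det n u v : below u -> ~~ below v ->
  0 < dot2 n u -> 0 < dot2 n v -> 0 < n.1 * det2 u v.
Proof.
move=> bu bv hu hv.
have -> : n.1 * det2 u v = dot2 n u * v.2 - u.2 * dot2 n v.
  by rewrite /det2 /dot2; ring.
move: hu hv; have [hu|[hu hu']] := belowP bu; have [hv|[hv hv']] := belowPn bv;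
  rewrite /dot2 ?hu ?hv => ? ?; nra.
Qed.

(** An open half plane with 0 on its boundary either contains the open ray ([0 < n.1]) or misses it,
    so the determinant test is constant there and [chi] reduces to a difference of values of
    [below]. This is why it is additive in [chi_chain]. *)
Lemma chiE n u v : 0 < dot2 n u -> 0 < dot2 n v ->
  chi u v = (0 < n.1) && (below u (+) below v).
Proof.
move=> hu hv; rewrite /chi.
have sgn x : 0 < n.1 * x -> (0 < x) = (0 < n.1).
  have [h|h|<-] := ltgtP 0 n.1; last by rewrite mul0r ltxx.
    by rewrite pmulr_rgt0.
  by rewrite nmulr_rgt0 // => ?; apply/negbTE; rewrite -leNgt ltW.
case bu : (below u); case bv : (below v); rewrite ?andbF //= andbT.
  by rewrite (sgn _ (below_det bu (negbT bv) hu hv)) eqb_id.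
have := below_det bv (negbT bu) hv hu.
have -> : det2 v u = - det2 u v by rewrite /det2; ring.
move=> h; rewrite -(sgn _ h) oppr_gt0 eqbF_neg -leNgt lt_neqAle.
by case: eqP h => // ->; rewrite oppr0 mulr0 ltxx.
Qed.

Lemma chi_chain n u v w : 0 < dot2 n u -> 0 < dot2 n v -> 0 < dot2 n w ->
  chi u w = chi u v (+) chi v w.
Proof.
move=> hu hv hw; rewrite (chiE hu hw) (chiE hu hv) (chiE hv hw).
by case: (0 < n.1) (below u) (below v) (below w) => [] [] [] [].
Qed.

Lemma chiC n u v : 0 < dot2 n u -> 0 < dot2 n v -> chi u v = chi v u.
Proof. by move=> hu hv; rewrite (chiE hu hv) (chiE hv hu) addbC. Qed.

Lemma chi_same u : chi u u = false.
Proof. by rewrite /chi addbb. Qed.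

Lemma belowN u : u != 0 -> below (- u) = ~~ below u.
Proof.
move=> u0; have : ~~ ((u.1 == 0) && (u.2 == 0)).
  by apply: contraNN u0 => /andP[/eqP u1 /eqP u2]; rewrite [u]surjective_pairing u1 u2.
rewrite /below /= oppr_lt0 oppr_eq0 oppr_lt0.
by case: (ltgtP u.2 0); case: (ltgtP u.1 0).
Qed.

(* A ray meets exactly one of two opposite sides of a parallelogram around 0,
   among those whose end points it separates. *)
Lemma chi_parallelogram u v : det2 u v != 0 ->
  chi u v (+) chi v (- u) (+) chi (- u) (- v) (+) chi (- v) u.
Proof.
move=> uv.
have u0 : u != 0 by apply: contraNneq uv => ->; rewrite /det2 !mul0r subrr.
have v0 : v != 0 by apply: contraNneq uv => ->; rewrite /det2 !mulr0 subrr.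
have d1 : det2 v (- u) = det2 u v by rewrite /det2 /=; ring.
have d2 : det2 (- u) (- v) = det2 u v by rewrite /det2 /=; ring.
have d3 : det2 (- v) u = det2 u v by rewrite /det2 /=; ring.
by rewrite /chi d1 d2 d3 !belowN //; case: (below u) (below v) (0 < _) => [] [] [].
Qed.

(** Discrete Stokes formula modulo 2: in the sum over all cells every inner edge occurs twice.
    [h i j] stands for the edge from (i, j) to (i + 1, j), [v i j] for the one from (i, j) to (i, j
    + 1). *)
Lemma sum_addb_cells (N M : nat) (h v : nat -> nat -> bool) :
  (forall i j, (i < N)%N -> (j < M)%N ->
    h i j (+) v i.+1 j (+) h i j.+1 (+) v i j = false) ->
  (\big[addb/false]_(i < N) h i 0%N (+) \big[addb/false]_(i < N) h i M)
  (+) (\big[addb/false]_(j < M) v 0%N j (+) \big[addb/false]_(j < M) v N j)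
  = false.
Proof.
move=> cell.
have row n j : (n <= N)%N -> (j < M)%N ->
    \big[addb/false]_(i < n) h i j (+) \big[addb/false]_(i < n) h i j.+1 =
    v 0%N j (+) v n j.
  elim: n => [|n IH] nN jM; first by rewrite !big_ord0 !addbb.
  rewrite !big_ord_recr /= addbACA IH ?(ltnW nN) //.
  have := cell n j nN jM.
  by case: (h n j) (h n j.+1) (v n j) (v n.+1 j) (v 0%N j) => [] [] [] [] [].
elim: M cell row => [|M IH] cell row; first by rewrite !big_ord0 !addbb.
rewrite !(big_ord_recr M) /=.
have := IH (fun i j hi hj => cell i j hi (leqW hj)) (fun n j hn hj => row n j hn (leqW hj)).
have := row N M (leqnn _) (ltnSn _).
by do !case: (\big[addb/false]_(_ < _) _); case: (v 0%N M); case: (v N M).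
Qed.

(* Parity of the crossings of the ray by the polygonal path through the values of
   k at the multiples of 1/N; for a closed curve k avoiding 0 and N large it is
   the parity of the winding number around 0. *)
Definition psum k N :=
  \big[addb/false]_(i < N) chi (k (i%:R / N%:R)) (k (i.+1%:R / N%:R)).

Lemma near_invn (e : R) : 0 < e -> \forall N \near \oo, (0 < N)%N /\ N%:R^-1 < e.
Proof.
move=> e0; near=> N; have N0 : (0 < N)%N by near: N; exact: nbhs_infty_gt.
split=> //; rewrite invf_plt ?posrE ?ltr0n //.
by near: N; exact: nbhs_infty_gtr.
Unshelve. all: end_near. Qed.

(* The boundary of a square mapped to the complement of 0 has winding number 0.
   G need not be continuous, which allows redefining it at isolated zeros. *)
Lemma psum_square (G : R -> R -> R * R) :
  (forall s t : R, 0 <= s <= 1 -> 0 <= t <= 1 -> exists n,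
    \forall s' \near s & t' \near t,
      0 <= s' <= 1 -> 0 <= t' <= 1 -> 0 < dot2 n (G s' t')) ->
  \forall N \near \oo,
    (psum (G^~ 0) N (+) psum (G^~ 1) N) (+) (psum (G 0) N (+) psum (G 1) N) = false.
Proof.
move=> HG.
(* Lebesgue number argument: compactness gives one mesh 1/N such that every grid cell is sent into
   some half plane, where [chi] sums to 0 around the cell. *)
pose P (N : nat) (z : R * R) := exists n, forall s t : R,
  0 <= s <= 1 -> 0 <= t <= 1 -> `|s - z.1| <= N%:R^-1 -> `|t - z.2| <= N%:R^-1 ->
  0 < dot2 n (G s t).
have K : compact (`[0, 1]%classic `*` `[0, 1]%classic : set (R * R)).
  by apply: compact_setX; exact: segment_compact.
have := (proj1 (compact_near_coveringP _) K) nat \oo P _.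
case.
  move=> [s t] [/=]; rewrite !in_itv /= => hs ht.
  have [n [[A B] /= [/nbhs_ballP[r1 /= r1p hA] /nbhs_ballP[r2 /= r2p hB]] AB]] := HG s t hs ht.
  pose r := Num.min r1 r2 / 2.
  have rp : 0 < r by rewrite divr_gt0// lt_min r1p.
  exists (ball (s, t) r, [set N | N%:R^-1 < r]) => /=.
    by split; [exact: nbhsx_ballx | apply: filterS (near_invn rp) => N []].
  move=> [[s1 t1] N] /= [[h1 h2] h3]; exists n => s' t' hs' ht' h4 h5.
  have hr1 : r *+ 2 <= r1 by rewrite -mulr_natr divfK// ge_min lexx.
  have hr2 : r *+ 2 <= r2 by rewrite -mulr_natr divfK// ge_min lexx orbT.
  have := AB (s', t') => /(_ _); apply => //; split.
    apply: hA; apply: (@le_ball _ _ _ (r + r)) => //; apply: (ball_triangle h1).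
    by rewrite /ball /= distrC (le_lt_trans h4).
  apply: hB; apply: (@le_ball _ _ _ (r + r)) => //; apply: (ball_triangle h2).
  by rewrite /ball /= distrC (le_lt_trans h5).
move=> N1 _ HN; exists (maxn N1 1) => // N /=; rewrite geq_max => /andP[/HN PN N0].
have Np : 0 < N%:R :> R by rewrite ltr0n.
have inI (i : nat) : (i <= N)%N -> 0 <= (i%:R / N%:R : R) <= 1.
  by move=> iN; rewrite divr_ge0 //= ler_pdivrMr // mul1r ler_nat.
have step (i : nat) : `|i.+1%:R / N%:R - i%:R / N%:R| <= (N%:R^-1 : R).
  by rewrite -mulrBl -natrB // subSnn mul1r ger0_norm ?invr_ge0 ?ler0n.
have step0 (i : nat) : `|i%:R / N%:R - i%:R / N%:R| <= (N%:R^-1 : R).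
  by rewrite subrr normr0 invr_ge0 ler0n.
pose V (i j : nat) := G (i%:R / N%:R) (j%:R / N%:R).
have cell i j : (i < N)%N -> (j < N)%N ->
    chi (V i j) (V i.+1 j) (+) chi (V i.+1 j) (V i.+1 j.+1)
    (+) chi (V i j.+1) (V i.+1 j.+1) (+) chi (V i j) (V i j.+1) = false.
  move=> iN jN.
  have [|n Hn] := PN (i%:R / N%:R, j%:R / N%:R); first by split; rewrite /= in_itv /= inI // ltnW.
  have P0 : 0 < dot2 n (V i j) by apply: Hn; rewrite ?inI ?step0 // ltnW.
  have P1 : 0 < dot2 n (V i.+1 j) by apply: Hn; rewrite ?inI ?step0 ?step // ltnW.
  have P2 : 0 < dot2 n (V i j.+1) by apply: Hn; rewrite ?inI ?step0 ?step // ltnW.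
  have P3 : 0 < dot2 n (V i.+1 j.+1) by apply: Hn; rewrite ?inI ?step ?step.
  rewrite (chiE P0 P1) (chiE P1 P3) (chiE P2 P3) (chiE P0 P2).
  by case: (0 < n.1) (below (V i j)) (below (V i.+1 j)) (below (V i j.+1))
    (below (V i.+1 j.+1)) => [] [] [] [] [].
have := @sum_addb_cells N N (fun i j => chi (V i j) (V i.+1 j))
  (fun i j => chi (V i j) (V i j.+1)) cell.
by rewrite /V /= mul0r divff ?gt_eqF.
Qed.

End RayCrossings.

(** * Two arcs with common end points: parity of the difference map *)

Section Theta.
Context {R : realType}.
Implicit Types (u v x y : R * R) (k ga be : R -> R * R).

(* One-sided tangent direction; positive factors do not matter. *)
Definition leaves k x :=
  forall n, 0 < dot2 n x -> \forall h \near 0^'+, 0 < dot2 n (k h - k 0).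

(* Translates of k through 0 at one end, where the value 0, which has no
   direction, is replaced by the tangent direction. *)
Definition from0 k x (s : R) := if s == 0 then x else k s - k 0.
Definition to1 k x (s : R) := if s == 1 then x else k s - k 1.

Lemma dot2D n u v : dot2 n (u + v) = dot2 n u + dot2 n v.
Proof. by rewrite /dot2 /=; ring. Qed.

Lemma dot2_continuous n : continuous (dot2 n : R * R -> R).
Proof.
move=> u; apply: cvgD; apply: cvgM; try exact: cvg_cst.
  exact: cvg_fst.
exact: cvg_snd.
Qed.

(** Only the first term depends on the initial value. For N large the chord [k (1/N) - k 0] lies
    with [x] and [y] in the half plane of [n], where [chi] is additive. *)
Lemma psum_from0 k n x y : 0 < dot2 n x -> 0 < dot2 n y -> leaves k x ->
  \forall N \near \oo, psum (from0 k x) N (+) psum (from0 k y) N = chi x y.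
Proof.
move=> nx ny /(_ n nx)[e /= e0 He].
apply: filterS (near_invn e0) => -[[]//|N] [_ hN].
have p : 0 < N.+1%:R^-1 :> R by rewrite invr_gt0.
have hc : 0 < dot2 n (k N.+1%:R^-1 - k 0).
  by apply: He => //; rewrite /ball /= sub0r normrN gtr0_norm.
have ne0 (i : nat) : (i.+1%:R / N.+1%:R == 0 :> R) = false.
  by apply/negbTE; rewrite mulf_neq0 ?invr_eq0 ?pnatr_eq0.
rewrite /psum !big_ord_recl addbACA.
rewrite -big_split big1 ?addbF; last first.
  by move=> i _; rewrite /from0 /= /bump /= !ne0 addbb.
rewrite /from0 mul0r eqxx !ne0 mul1r.
by rewrite (chiC ny hc) -(chi_chain nx hc ny).
Qed.

Lemma psum_to1 k n x y : 0 < dot2 n x -> 0 < dot2 n y ->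
  leaves (fun s => k (1 - s)) x ->
  \forall N \near \oo, psum (to1 k x) N (+) psum (to1 k y) N = chi x y.
Proof.
move=> nx ny /(_ n nx)[e /= e0 He].
apply: filterS (near_invn e0) => -[[]//|N] [_ hN].
have N0 : N.+1%:R != 0 :> R by rewrite pnatr_eq0.
have p : 0 < N.+1%:R^-1 :> R by rewrite invr_gt0.
have e1 : N%:R / N.+1%:R = 1 - N.+1%:R^-1 :> R.
  by apply: (mulIf N0); rewrite divfK // mulrBl mulVf // -[in RHS]natr1; ring.
have hc : 0 < dot2 n (k (N%:R / N.+1%:R) - k 1).
  rewrite e1 -[in k 1](subr0 1); apply: (He N.+1%:R^-1) => //.
  by rewrite /ball /= sub0r normrN gtr0_norm.
have ne1 (i : nat) : (i < N.+1)%N -> (i%:R / N.+1%:R == 1 :> R) = false.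
  by move=> iN; apply/negbTE; rewrite lt_eqF // ltr_pdivrMr ?ltr0n // mul1r ltr_nat.
rewrite /psum !big_ord_recr addbACA.
rewrite -big_split big1 ?addFb; last first.
  by move=> [i iN] _; rewrite /to1 /= !ne1 ?addbb // ltnS ltnW.
rewrite /to1 /= divff // eqxx !ne1 //.
by rewrite (chiC hc nx) -(chi_chain nx hc ny).
Qed.

Lemma leaves_ge0 k n x : leaves k x -> 0 < dot2 n x ->
  exists2 e : R, 0 < e & forall h : R, 0 <= h -> h < e -> h = 0 \/ 0 < dot2 n (k h - k 0).
Proof.
move=> kx /(kx n)[e /= e0 He]; exists e => // h h0 he.
have [|hn0] := eqVneq h 0; [by left | right].
apply: He; last by rewrite lt_def hn0.
by rewrite /ball /= sub0r normrN ger0_norm.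
Qed.

(* psum_square for (s, t) |-> ga s + be t, which vanishes at the corners (0, 0)
   and (1, 1) only: there it takes values in a half plane, so it can be redefined
   to be x, resp. x'. The edges s = 0 and s = 1 then start or end with x or x'
   instead of y or y', which accounts for chi x y and chi x' y'. *)
Lemma chi_theta ga be x y x' y' :
  continuous ga -> continuous be ->
  ga 0 + be 0 = 0 -> ga 1 + be 1 = 0 ->
  (forall s t : R, 0 <= s <= 1 -> 0 <= t <= 1 -> ga s + be t = 0 ->
    (s = 0 /\ t = 0) \/ (s = 1 /\ t = 1)) ->
  leaves ga x -> leaves be y ->
  leaves (fun s => ga (1 - s)) x' -> leaves (fun s => be (1 - s)) y' ->
  (exists n, 0 < dot2 n x /\ 0 < dot2 n y) ->
  (exists n, 0 < dot2 n x' /\ 0 < dot2 n y') ->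
  \forall N \near \oo,
    (psum (from0 ga x) N (+) psum (to1 ga x') N) (+)
    (psum (from0 be y) N (+) psum (to1 be y') N) = chi x y (+) chi x' y'.
Proof.
move=> cga cbe e0 e1 inj gax bey gax' bey' [n [nx ny]] [n' [nx' ny']].
pose F (s t : R) := ga s + be t.
pose G (s t : R) := if (s == 0) && (t == 0) then x else
  if (s == 1) && (t == 1) then x' else F s t.
have n01 : (0 == 1 :> R) = false by rewrite eq_sym oner_eq0.
have n10 : (1 == 0 :> R) = false by rewrite oner_eq0.
have GE m s t : 0 < dot2 m (F s t) -> G s t = F s t.
  rewrite /G; case: andP => [[/eqP-> /eqP->]|_].
    by rewrite /F e0 /dot2 /= !mulr0 addr0 ltxx.
  case: andP => [[/eqP-> /eqP->]|//].
  by rewrite /F e1 /dot2 /= !mulr0 addr0 ltxx.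
have HG : forall s t : R, 0 <= s <= 1 -> 0 <= t <= 1 -> exists n,
    \forall s' \near s & t' \near t,
      0 <= s' <= 1 -> 0 <= t' <= 1 -> 0 < dot2 n (G s' t').
  move=> s t s01 t01.
  have [[s0 t0]|] := pselect (s = 0 /\ t = 0).
    subst s t; clear s01 t01; exists n.
    have [e ep He] := leaves_ge0 gax nx; have [f fp Hf] := leaves_ge0 bey ny.
    exists (ball 0 e, ball 0 f); first by split; exact: nbhsx_ballx.
    move=> [s t]; rewrite /ball /= !sub0r !normrN => -[hs ht] /andP[s0 _] /andP[t0 _].
    have FE : dot2 n (F s t) = dot2 n (ga s - ga 0) + dot2 n (be t - be 0).
      by rewrite -dot2D addrACA -opprD e0 subr0.
    rewrite !ger0_norm // in hs ht.
    have pF : 0 < dot2 n (F s t) -> 0 < dot2 n (G s t) by move=> h; rewrite (GE _ _ _ h).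
    have [s00|ps] := He s s0 hs; have [t00|pt] := Hf t t0 ht.
    - by rewrite /G s00 t00 eqxx.
    - by apply: pF; rewrite FE s00 subrr /dot2 /= !mulr0 !add0r.
    - by apply: pF; rewrite FE t00 subrr [X in _ + X]/dot2 /= !mulr0 !addr0.
    - by apply: pF; rewrite FE addr_gt0.
  move=> st0; have [[s1 t1]|st1] := pselect (s = 1 /\ t = 1).
    subst s t; clear s01 t01; exists n'.
    have [e ep He] := leaves_ge0 gax' nx'; have [f fp Hf] := leaves_ge0 bey' ny'.
    exists (ball (1 : R) e, ball (1 : R) f); first by split; exact: nbhsx_ballx.
    move=> [s t]; rewrite /ball /= => -[+ +] /andP[_ s1] /andP[_ t1].
    rewrite !ger0_norm ?subr_ge0 // => hs ht.
    have FE : dot2 n' (F s t) = dot2 n' (ga s - ga 1) + dot2 n' (be t - be 1).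
      by rewrite -dot2D addrACA -opprD e1 subr0.
    have pF : 0 < dot2 n' (F s t) -> 0 < dot2 n' (G s t) by move=> h; rewrite (GE _ _ _ h).
    have := He (1 - s); have := Hf (1 - t).
    rewrite !subr_ge0 !subr0 !subKr => /(_ t1 ht) ot /(_ s1 hs) os.
    have [s11|ps] := os; have [t11|pt] := ot.
    - move/eqP: s11; rewrite subr_eq0 => /eqP <-; move/eqP: t11; rewrite subr_eq0 => /eqP <-.
      by rewrite /G eqxx n10.
    - apply: pF; move/eqP: s11; rewrite FE subr_eq0 => /eqP <-.
      by rewrite subrr /dot2 /= !mulr0 !add0r.
    - apply: pF; move/eqP: t11; rewrite FE subr_eq0 => /eqP <-.
      by rewrite subrr [X in _ + X]/dot2 /= !mulr0 !addr0.
    - by apply: pF; rewrite FE addr_gt0.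
  (* Away from the two corners the nonzero value serves as its own normal: by continuity nearby
     values have positive product with it. *)
  exists (F s t).
  have F0 : 0 < dot2 (F s t) (F s t).
    rewrite lt_def /dot2 -!expr2 addr_ge0 ?sqr_ge0 // andbT paddr_eq0 ?sqr_ge0 // !sqrf_eq0.
    apply/negP => /andP[/eqP F1 /eqP F2].
    have /(inj _ _ s01 t01) : ga s + be t = 0 by rewrite -/(F s t) [F s t]surjective_pairing F1 F2.
    by case=> // -[].
  have cF : (fun z : R * R => dot2 (F s t) (F z.1 z.2)) @ (s, t) --> dot2 (F s t) (F s t).
    have cF' : (fun z : R * R => F z.1 z.2) @ (s, t) --> F s t.
      apply: cvgD.
        by apply: (@continuous_comp _ _ _ fst ga (s, t)); [exact: cvg_fst | exact: cga].
      by apply: (@continuous_comp _ _ _ snd be (s, t)); [exact: cvg_snd | exact: cbe].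
    exact: (cvg_comp _ _ cF' (@dot2_continuous _ _)).
  apply: (@filterS _ (nbhs (s, t)) _ _ _ _ (cF _ (lt_nbhsr F0))) => -[s' t'] /= h _ _.
  by rewrite (GE _ _ _ h).
have ga0 : be 0 = - ga 0 by apply/eqP; rewrite -addr_eq0 addrC e0.
have ga1 : be 1 = - ga 1 by apply/eqP; rewrite -addr_eq0 addrC e1.
have GB : G^~ 0 = from0 ga x.
  by apply/funext => s; rewrite /G /from0 eqxx n01 andbF andbT /F ga0.
have GT : G^~ 1 = to1 ga x'.
  by apply/funext => s; rewrite /G /to1 eqxx n10 andbF andbT /F ga1.
have GL : G 0 = from0 be x.
  apply/funext => s; rewrite /G /from0 eqxx n01 /= /F ga0 opprK.
  by case: ifP => // _; exact: addrC.
have GR : G 1 = to1 be x'.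
  apply/funext => s; rewrite /G /to1 eqxx n10 /= /F ga1 opprK.
  by case: ifP => // _; exact: addrC.
have := psum_square HG; rewrite GB GT GL GR.
apply: filter_app.
apply: filterS2 (psum_from0 ny nx bey) (psum_to1 ny' nx' bey') => N.
rewrite (chiC nx ny) (chiC nx' ny') => <- <-.
by do !case: (psum _ N) => //.
Qed.

End Theta.

(** * Planar curves with interlaced double points *)

Section Interlaced.
Context {R : realType}.
Implicit Types (u v x y : R * R) (k g : R -> R * R) (p q : R).

(** Only the direction of [v] counts. Tangency is tested by half planes, so the plane curve need not
    be differentiated. *)
Definition tangent g p v := forall n, 0 < dot2 n v ->
  \forall h \near 0^'+, 0 < dot2 n (g (p + h) - g p) /\ 0 < dot2 n (g p - g (p - h)).

Definition seg g p q (s : R) := g (p + s * (q - p)).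

Lemma dot2N n u : dot2 n (- u) = - dot2 n u.
Proof. by rewrite /dot2 /=; ring. Qed.

Lemma dot2Nl n u : dot2 (- n) u = - dot2 n u.
Proof. by rewrite /dot2 /=; ring. Qed.

Lemma near0_scale (P : R -> Prop) (r : R) : 0 < r ->
  (\forall h \near 0^'+, P h) -> \forall h \near 0^'+, P (h * r).
Proof.
move=> r0 [e /= e0 He]; exists (e / r) => /=; first by rewrite divr_gt0.
move=> h; rewrite /ball /= sub0r normrN => he h0; apply: He; last by rewrite mulr_gt0.
by rewrite /ball /= sub0r normrN normrM (gtr0_norm r0) -ltr_pdivlMr.
Qed.

Lemma leaves_seg_lt g p q v : p < q -> tangent g p v -> leaves (seg g p q) v.
Proof.
move=> pq gv n nv; have qp : 0 < q - p by rewrite subr_gt0.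
have := near0_scale qp (gv n nv); apply: filterS => h [+ _].
by rewrite /seg mul0r addr0.
Qed.

Lemma leaves_seg_gt g p q v : q < p -> tangent g p v -> leaves (seg g p q) (- v).
Proof.
move=> pq gv n nv; have qp : 0 < p - q by rewrite subr_gt0.
have nv' : 0 < dot2 (- n) v by rewrite dot2Nl -dot2N.
have := near0_scale qp (gv _ nv'); apply: filterS => h [_].
by rewrite dot2Nl -dot2N opprB /seg mul0r addr0 -mulrN opprB.
Qed.

Lemma leavesN k v : leaves k v -> leaves (fun s => - k s) (- v).
Proof.
move=> kv n; rewrite dot2N -dot2Nl => /kv; apply: filterS => h.
by rewrite -opprD dot2N -dot2Nl.
Qed.

Lemma seg_rev g p q : (fun s => seg g p q (1 - s)) = seg g q p.
Proof. by apply/funext => s; rewrite /seg; congr g; ring. Qed.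

Lemma seg_continuous g p q : continuous g -> continuous (seg g p q).
Proof.
move=> cg s; apply: (cvg_comp (fun s : R => p + s * (q - p)) g _ (cg _)).
by apply: cvgD; [exact: cvg_cst | apply: cvgM; [exact: cvg_id | exact: cvg_cst]].
Qed.

Lemma dual_basis u v : det2 u v != 0 ->
  forall i j, exists n, dot2 n u = i /\ dot2 n v = j.
Proof.
move=> uv i j; exists ((i * v.2 - j * u.2) / det2 u v, (j * u.1 - i * v.1) / det2 u v).
by split; rewrite /dot2 /=; move: uv; rewrite /det2 => uv; field.
Qed.

(* The four arcs of g, oriented from A = g p1 to B = g p2, are e1 (p1 to p2),
   e2 (p3 to p2), e3 (p3 to p4) and e4 (p5 to p4). Adding chi_theta for the pairs
   (- ei, ej) with i = 1, 2 and j = 3, 4, the path sums cancel in pairs; so do the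
   angle terms at A, while those at B form a parallelogram around 0. *)
Lemma no_interlaced_curve g (p1 p2 p3 p4 p5 : R) u w a b :
  p1 < p2 -> p2 < p3 -> p3 < p4 -> p4 < p5 ->
  continuous g -> g p1 = g p3 -> g p5 = g p3 -> g p4 = g p2 ->
  tangent g p1 u -> tangent g p5 u -> tangent g p3 w ->
  tangent g p2 a -> tangent g p4 b ->
  det2 u w != 0 -> det2 a b != 0 ->
  (forall s t, p1 <= s <= p3 -> p3 <= t <= p5 -> g s = g t ->
    (s = p2 /\ t = p4) \/ ((s = p1 \/ s = p3) /\ (t = p3 \/ t = p5))) ->
  False.
Proof.
move=> p12 p23 p34 p45 cg g13 g53 g42 g1 g5 g3 g2 g4 uw ab inj.
have th p q (x x' : R * R) r s y y' :
    (p = p1 \/ p = p3) -> q = p2 -> (r = p3 \/ r = p5) -> s = p4 ->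
    leaves (fun t => - seg g p q t) x -> leaves (fun t => - seg g q p t) x' ->
    leaves (seg g r s) y -> leaves (seg g s r) y' ->
    (exists n, 0 < dot2 n x /\ 0 < dot2 n y) ->
    (exists n, 0 < dot2 n x' /\ 0 < dot2 n y') ->
    \forall N \near \oo,
      (psum (from0 (fun t => - seg g p q t) x) N (+)
       psum (to1 (fun t => - seg g p q t) x') N) (+)
      (psum (from0 (seg g r s) y) N (+) psum (to1 (seg g r s) y') N)
      = chi x y (+) chi x' y'.
  move=> hp -> hr -> l1 l2 l3 l4 n1 n2.
  have gp : g p = g p3 by case: hp => ->.
  have gr : g r = g p3 by case: hr => ->.
  have pq : p != p2 by case: hp => ->; lra.
  have rs : r != p4 by case: hr => ->; lra.
  apply: chi_theta => //.
  - by move=> t; apply: cvgN; exact: seg_continuous.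
  - exact: seg_continuous.
  - by rewrite /seg !mul0r !addr0 gp gr addNr.
  - by rewrite /seg !mul1r !subrKC g42 addNr.
  - move=> t t' ht ht' /eqP; rewrite addrC subr_eq0 eq_sym => /eqP /inj.
    move=> sgt.
    have between (c d e : R) : 0 <= e <= 1 -> c <= d ->
        c <= c + e * (d - c) <= d /\ c <= d + e * (c - d) <= d.
      move=> /andP[h0 h1]; rewrite -subr_ge0 => cd.
      have := mulr_ge0 h0 cd; have := ler_piMl cd h1; clear.
      by rewrite -(opprB d c) mulrN => ? ?; split; apply/andP; split; lra.
    have [b1 _] := between _ _ _ ht (ltW p12); have [_ b2] := between _ _ _ ht (ltW p23).
    have [b3 _] := between _ _ _ ht' (ltW p34); have [_ b4] := between _ _ _ ht' (ltW p45).
    have ht1 : p1 <= p + t * (p2 - p) <= p3.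
      by clear - p12 p23 hp b1 b2; case: hp => ->; lra.
    have ht2 : p3 <= r + t' * (p4 - r) <= p5.
      by clear - p34 p45 hr b3 b4; case: hr => ->; lra.
    have eq0 (c d e : R) : c != d -> c + e * (d - c) = c -> e = 0.
      move=> cd /eqP; rewrite addrC -subr_eq0 addrK mulf_eq0 => /orP[/eqP //|].
      by rewrite subr_eq0 eq_sym (negbTE cd).
    have eq1 (c d e : R) : c != d -> c + e * (d - c) = d -> e = 1.
      move=> cd /eqP; rewrite -subr_eq0 (_ : _ - _ = (e - 1) * (d - c)); last by ring.
      rewrite mulf_eq0 => /orP[|]; first by rewrite subr_eq0 => /eqP.
      by rewrite subr_eq0 eq_sym (negbTE cd).
    case: (sgt ht1 ht2) => [[/(eq1 _ _ _ pq) ? /(eq1 _ _ _ rs) ?]|[h1 h2]]; [by right | left].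
    split; [apply: (eq0 _ _ _ pq) | apply: (eq0 _ _ _ rs)].
      by clear - p12 p23 hp h1 b1 b2; case: hp h1 b1 b2 => ->; case; lra.
    by clear - p34 p45 hr h2 b3 b4; case: hr h2 b3 b4 => ->; case; lra.
  - rewrite (_ : (fun _ => _) = (fun t => - seg g p2 p t)) //.
    by apply/funext => t; rewrite -(seg_rev g p2 p) subKr.
  - by rewrite seg_rev.
(* At A the arcs - e1 and e4 leave along [- u], the arcs - e2 and e3 along [w], and [m] is positive
   on both. The angle terms at A are thus [chi (- u) w], 0, 0 and [chi w (- u)], which cancel: a
   touching contributes nothing. *)
have [m [mu mw]] := dual_basis uw (-1) 1.
have {mu} mu : 0 < dot2 m (- u) by rewrite dot2N mu opprK.
have {mw} mw : 0 < dot2 m w by rewrite mw.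
have nab (i j : R) : exists n, dot2 n a = i /\ dot2 n b = j := dual_basis ab i j.
have l1 := leavesN (leaves_seg_lt p12 g1); have l1' := leavesN (leaves_seg_gt p12 g2).
have l2 := leavesN (leaves_seg_gt p23 g3); have l2' := leavesN (leaves_seg_lt p23 g2).
have l3 := leaves_seg_lt p34 g3; have l3' := leaves_seg_gt p34 g4.
have l4 := leaves_seg_gt p45 g5; have l4' := leaves_seg_lt p45 g4.
rewrite !opprK in l1' l2.
have H13 := th _ _ _ _ _ _ _ _ (or_introl erefl) erefl (or_introl erefl) erefl l1 l1' l3 l3'.
have H14 := th _ _ _ _ _ _ _ _ (or_introl erefl) erefl (or_intror erefl) erefl l1 l1' l4 l4'.
have H23 := th _ _ _ _ _ _ _ _ (or_intror erefl) erefl (or_introl erefl) erefl l2 l2' l3 l3'.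
have H24 := th _ _ _ _ _ _ _ _ (or_intror erefl) erefl (or_intror erefl) erefl l2 l2' l4 l4'.
have {H13}/H13 H13 : exists n, 0 < dot2 n (- u) /\ 0 < dot2 n w by exists m.
have {H14}/H14 H14 : exists n, 0 < dot2 n (- u) /\ 0 < dot2 n (- u) by exists m.
have {H23}/H23 H23 : exists n, 0 < dot2 n w /\ 0 < dot2 n w by exists m.
have {H24}/H24 H24 : exists n, 0 < dot2 n w /\ 0 < dot2 n (- u) by exists m.
have {H13}/H13 H13 : exists n, 0 < dot2 n a /\ 0 < dot2 n (- b).
  by have [n [na nb]] := nab 1 (-1); exists n; rewrite !dot2N na nb; split; lra.
have {H14}/H14 H14 : exists n, 0 < dot2 n a /\ 0 < dot2 n b.
  by have [n [na nb]] := nab 1 1; exists n; rewrite na nb; split; lra.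
have {H23}/H23 H23 : exists n, 0 < dot2 n (- a) /\ 0 < dot2 n (- b).
  by have [n [na nb]] := nab (-1) (-1); exists n; rewrite !dot2N na nb; split; lra.
have {H24}/H24 H24 : exists n, 0 < dot2 n (- a) /\ 0 < dot2 n b.
  by have [n [na nb]] := nab (-1) 1; exists n; rewrite !dot2N na nb; split; lra.
have [N [[]]] := filter_ex (filterI (filterI H13 H14) (filterI H23 H24)).
rewrite !chi_same (chiC mw mu) => e13 e14 [e23 e24].
have := chi_parallelogram ab.
have -> : chi b (- a) = chi (- a) b.
  by have [n [na nb]] := nab (-1) 1; apply: (@chiC _ n); rewrite ?dot2N ?na ?nb; lra.
have -> : chi (- b) a = chi a (- b).
  by have [n [na nb]] := nab 1 (-1); apply: (@chiC _ n); rewrite ?dot2N ?na ?nb; lra.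
have: (chi (- u) w (+) chi a (- b)) (+) (false (+) chi a b) (+)
    (false (+) chi (- a) (- b)) (+) (chi (- u) w (+) chi (- a) b) = false.
  rewrite -e13 -e14 -e23 -e24; do 4 move: (psum (from0 _ _) N (+) psum (to1 _ _) N).
  by clear; do 4 case.
move: (chi (- u) w) (chi a (- b)) (chi a b) (chi (- a) (- b)) (chi (- a) b).
by clear; do 5 case.
Qed.
End Interlaced.

(** * Immersions in the sphere *)

Section Space.
Context {R : realType}.
Implicit Types (a b x y z : 'rV[R]_3) (f : R -> 'rV[R]_3).

Definition dot3 a b := \sum_i a 0 i * b 0 i.

Lemma dot3C a b : dot3 a b = dot3 b a.
Proof. by apply: eq_bigr => i _; rewrite mulrC. Qed.

Lemma dot3D a b z : dot3 a (b + z) = dot3 a b + dot3 a z.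
Proof. by rewrite -big_split; apply: eq_bigr => i _; rewrite mxE mulrDr. Qed.

Lemma dot3Z a b k : dot3 a (k *: b) = k * dot3 a b.
Proof. by rewrite mulr_sumr; apply: eq_bigr => i _; rewrite mxE mulrCA. Qed.

Lemma dot3N a b : dot3 a (- b) = - dot3 a b.
Proof. by rewrite -scaleN1r dot3Z mulN1r. Qed.

Lemma dot3B a b z : dot3 a (b - z) = dot3 a b - dot3 a z.
Proof. by rewrite dot3D dot3N. Qed.

Lemma dot30 a : dot3 a 0 = 0.
Proof. by rewrite -(scale0r 0) dot3Z mul0r. Qed.

Lemma dot3Nl a x : dot3 (- a) x = - dot3 a x.
Proof. by rewrite dot3C dot3N dot3C. Qed.

Lemma dot3Dl a z x : dot3 (a + z) x = dot3 a x + dot3 z x.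
Proof. by rewrite dot3C dot3D !(dot3C x). Qed.

Lemma dot3Zl k a x : dot3 (k *: a) x = k * dot3 a x.
Proof. by rewrite dot3C dot3Z (dot3C x). Qed.

Lemma dot3_eq0 a : (dot3 a a == 0) = (a == 0).
Proof.
apply/idP/eqP => [|->]; last by rewrite dot30.
rewrite psumr_eq0 => [/allP h|i _]; last by rewrite -expr2 sqr_ge0.
apply/rowP => i; rewrite mxE; apply/eqP.
by have := h i (mem_index_enum _); rewrite /= mulf_eq0 orbb.
Qed.

Lemma dot3_gt0 a : (0 < dot3 a a) = (a != 0).
Proof.
rewrite lt_def dot3_eq0 sumr_ge0 ?andbT // => i _.
by rewrite -expr2 sqr_ge0.
Qed.

Lemma sphereE x : sphere x <-> dot3 x x = 1.
Proof.
by rewrite /sphere /=; split => <-; apply: eq_bigr => i _; rewrite expr2.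
Qed.

Lemma dot3_continuous a : continuous (dot3 a).
Proof.
apply: continuous_big => [|i _ x]; first exact: add_continuous.
exact: (cvg_comp _ _ (@coord_continuous _ _ _ 0 i x) (@mulrl_continuous _ _ (x 0 i))).
Qed.

Lemma immersion_cvg f t : generic_immersion f ->
  (fun h => h^-1 *: (f (t + h) - f t)) @ (0 : R)^' --> derive1 f t.
Proof.
move=> /gi_smooth /(_ [::]) [_ /(_ t (1 : R))] /=.
rewrite /derivable derive1E /derive => df.
set F := (fun h => _).
rewrite (_ : F = fun h : R => h^-1 *: ((f \o shift t) (h *: (1 : R^o)) - f t)) //.
by apply/funext => h; rewrite /F /= [h *: _]mulr1 [t + h]addrC.
Qed.


Lemma immersion_derive1_continuous f : generic_immersion f -> continuous (derive1 f).
Proof.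
move=> /gi_smooth /(_ [:: (1 : R^o)]) [+ _] /=.
have e : derive1 f = 'D_(1 : R^o) f by apply/funext => t; exact: derive1E.
by rewrite e.
Qed.

Lemma immersion_continuous f : generic_immersion f -> continuous f.
Proof. by move=> /gi_smooth /(_ [::])[]. Qed.

(** First order expansion seen through a linear form; the bound in [|h|] covers h = 0, and reduces
    later comparisons of branches to real inequalities. *)
Lemma dot3_increment f t a e : generic_immersion f -> 0 < e ->
  \forall h \near (0 : R),
    `|dot3 a (f (t + h) - f t) - h * dot3 a (derive1 f t)| <= e * `|h|.
Proof.
move=> fi e0.
have := cvg_comp _ _ (@immersion_cvg _ t fi) (@dot3_continuous a _).
move=> /cvgr_dist_lt /(_ e e0) [r /= r0 Hr].
exists r => // h /= hr; have [->|h0] := eqVneq h 0.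
  by rewrite addr0 subrr dot30 mul0r subrr normr0 mulr0.
have := Hr h hr h0; rewrite dot3Z => /ltW he.
have -> : dot3 a (f (t + h) - f t) - h * dot3 a (derive1 f t) =
  - (dot3 a (derive1 f t) - h^-1 * dot3 a (f (t + h) - f t)) * h by field.
by rewrite normrM normrN ler_wpM2r.
Qed.
End Space.

(** * Local injectivity and finiteness of the double points *)

Section DoublePoints.
Context {R : realType}.
Implicit Types (a b : 'rV[R]_3) (f : R -> 'rV[R]_3).

Lemma immersion_tangent f t a : generic_immersion f -> 0 < dot3 a (derive1 f t) ->
  \forall h \near 0^'+,
    0 < dot3 a (f (t + h) - f t) /\ 0 < dot3 a (f t - f (t - h)).
Proof.
set d := dot3 a _ => fi d0.
have [r /= r0 Hr] := dot3_increment t a fi (divr_gt0 d0 (ltr0Sn _ 1)).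
exists r => //= h; rewrite /ball /= sub0r normrN => hr h0.
have := Hr h; have := Hr (- h); rewrite /ball /= sub0r !normrN sub0r normrN.
move=> /(_ hr) + /(_ hr); rewrite (gtr0_norm h0) -/d !dot3B.
move: (dot3 a (f t)) (dot3 a (f (t + h))) (dot3 a (f (t - h))) => p q q'.
rewrite !ler_norml => /andP[? ?] /andP[? ?]; split; nra.
Qed.

Lemma periodic_int (T : Type) (f : R -> T) t k :
  (forall s, f (s + 1) = f s) -> k \is a Num.int -> f (t + k) = f t.
Proof.
move=> per /intrP[m ->{k}].
have pos (n : nat) u : f (u + n%:R) = f u.
  elim: n => [|n IH]; first by rewrite addr0.
  by rewrite -natr1 addrA per.
case: m => n; rewrite ?NegzE; first exact: pos.
by rewrite mulrNz -[in RHS](subrK n.+1%:R t) pos.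
Qed.

Lemma immersion_int f t k : generic_immersion f -> k \is a Num.int -> f (t + k) = f t.
Proof. by move=> /gi_periodic; exact: periodic_int. Qed.

(** The coordinate of [f] along its velocity at [t] has positive derivative near [t], so by the mean
    value theorem it takes no value twice there. *)
Lemma immersion_inj_near f t : generic_immersion f ->
  exists2 r, 0 < r &
    forall s s', `|s - t| < r -> `|s' - t| < r -> f s = f s' -> s = s'.
Proof.
move=> fi; set a := derive1 f t.
have : (fun s => dot3 a (derive1 f s)) @ t --> dot3 a a.
  exact: (cvg_comp _ _ (immersion_derive1_continuous fi (x := t)) (@dot3_continuous _ _ _)).
have aa : 0 < dot3 a a by rewrite dot3_gt0 (gi_immersion fi).
move=> /(_ _ (lt_nbhsr aa))[r /= r0 Hr]; exists r => //.
have dphi s : is_derive (s : R) 1 (fun s => dot3 a (f s)) (dot3 a (derive1 f s)).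
  have H : (fun h => h^-1 *: (((fun s => dot3 a (f s)) \o shift s) (h *: (1 : R)) - dot3 a (f s)))
      @ 0^' --> dot3 a (derive1 f s).
    rewrite (_ : (fun h => _) = (fun h => dot3 a (h^-1 *: (f (s + h) - f s)))).
      exact: (cvg_comp _ _ (immersion_cvg fi (t := s)) (@dot3_continuous _ _ _)).
    by apply/funext => h; rewrite dot3Z dot3B /= [h *: _]mulr1 [h + s]addrC.
  by split; [apply: cvgP H | exact: cvg_lim H].
have cphi s : derivable (fun s => dot3 a (f s)) (s : R) 1 by case: (dphi s).
have lt s s' : `|s - t| < r -> `|s' - t| < r -> f s = f s' -> s < s' -> False.
  move=> hs hs' e ss.
  have [u uss] := MVT ss (fun (v : R) _ => dphi v)
    (derivable_within_continuous (fun (v : R) _ => cphi v)).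
  rewrite e subrr => /esym/eqP; rewrite mulf_eq0 subr_eq0 (gt_eqF ss) orbF => /eqP du.
  suff hu : `|t - u| < r by have := Hr u hu; rewrite /= du ltxx.
  move: uss; rewrite in_itv /= => /andP[u1 u2].
  rewrite !ltr_norml in hs hs' *; clear - hs hs' u1 u2; lra.
move=> s s' hs hs' e; have [ss|ss|//] := ltgtP s s'.
  by case: (lt _ _ hs hs' e ss).
by case: (lt _ _ hs' hs (esym e) ss).
Qed.

(* near_covering along the filter of sets that contain a given finite set. *)
Lemma compact_isolated_finite (T : topologicalType) (K D : set T) :
  compact K -> (forall z : T, K z -> \forall z' \near z, D z' -> z' = z) ->
  finite_set (K `&` D).
Proof.
move=> cK HD.
pose F : set_system (set T) := filter_from finite_set (fun A => [set B | A `<=` B]).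
have FF : Filter F.
  apply: filter_from_filter; first by exists set0.
  move=> A B fA fB; exists (A `|` B); first by rewrite finite_setU.
  by move=> C /= ABC; split => z ?; apply: ABC; [left|right].
have [|A fA HA] := (proj1 (compact_near_coveringP _) cK) _ F (fun A z => D z -> A z) FF.
  move=> z Kz; exists ([set z' | D z' -> z' = z], [set B | [set z] `<=` B]) => /=.
    by split; [exact: HD | exists [set z]].
  by move=> [z' B] /= [h1 h2] /h1 ->; apply: h2.
by apply: (sub_finite_set _ fA) => z [Kz Dz]; exact: (HA A (@subset_refl _ A)).
Qed.

(** The columns of a right inverse are linear forms dual to the rows. *)
Lemma row_free_dual a b : row_free (col_mx a b) ->
  (exists c, dot3 c a = 1 /\ dot3 c b = 0) /\ (exists c, dot3 c a = 0 /\ dot3 c b = 1).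
Proof.
move=> /row_freeP[B]; rewrite mul_col_mx => e.
have ent (u : 'rV[R]_3) j : dot3 (col j B)^T u = (u *m B) 0 j.
  by rewrite mxE; apply: eq_bigr => i _; rewrite !mxE mulrC.
have ea : a *m B = usubmx 1%:M by rewrite -e col_mxKu.
have eb : b *m B = dsubmx 1%:M by rewrite -e col_mxKd.
by split; [exists (col (lshift 1 0) B)^T | exists (col (rshift 1 0) B)^T];
  rewrite !ent ea eb !mxE /=.
Qed.

Definition double_param f s := exists t, s - t \isn't a Num.int /\ f s = f t.

(** Pairs of parameters with the same image are isolated in a compact square: different images stay
    different by continuity, parameters equal modulo 1 are handled by local injectivity, and a
    genuine double pair by transversality. *)
Lemma finite_double_param f u : generic_immersion f ->
  finite_set [set s | u <= s <= u + 1 /\ double_param f s].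
Proof.
move=> fi.
(* To be used with p = [|s' - s|] and q = [|t' - t|]. Forms dual to the two velocities bound both p
   and q by (p + q) / 4, whence p + q <= (p + q) / 2; any constant below 1/2 in place of 1/4 would
   do. *)
have zero (p q a1 b1 a2 b2 : R) : 0 <= p -> 0 <= q -> p <= a1 + b1 -> q <= a2 + b2 ->
    b1 <= 4^-1 * p -> a1 <= 4^-1 * q -> a2 <= 4^-1 * p -> b2 <= 4^-1 * q ->
    p = 0 /\ q = 0.
  by move=> *; split; lra.
pose K : set (R * R) := `[u, u + 1]%classic `*` `[u, u + 1]%classic.
pose D : set (R * R) := [set z | z.1 - z.2 \isn't a Num.int /\ f z.1 = f z.2].
have KD : finite_set (K `&` D).
  apply: compact_isolated_finite; first by apply: compact_setX; exact: segment_compact.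
  move=> [s t] _; have [e|ne] := pselect (f s = f t); last first.
    pose a := f s - f t.
    have aa : 0 < dot3 a (f s) - dot3 a (f t) by rewrite -dot3B dot3_gt0 subr_eq0; apply/eqP.
    have cf : continuous (fun s => dot3 a (f s)).
      move=> s'; exact: (cvg_comp _ _ (immersion_continuous fi (x := s'))
        (@dot3_continuous _ _ _)).
    have : (fun z : R * R => dot3 a (f z.1) - dot3 a (f z.2)) @ (s, t) -->
        dot3 a (f s) - dot3 a (f t).
      apply: cvgB.
        apply: (@continuous_comp _ _ _ fst (fun s => dot3 a (f s)) (s, t)).
          exact: cvg_fst.
        exact: cf.
      apply: (@continuous_comp _ _ _ snd (fun s => dot3 a (f s)) (s, t)).
        exact: cvg_snd.
      exact: cf.
    move=> /(_ _ (lt_nbhsr aa)) H.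
    apply: (@filterS _ (nbhs (s, t)) _ _ _ _ H) => -[s' t'] h [_ /= e'].
    by move: h; rewrite /= e' subrr ltxx.
  have [st|st] := boolP (s - t \is a Num.int).
    have [r r0 Hr] := immersion_inj_near s fi.
    exists (ball s r, ball t r); first by split; exact: nbhsx_ballx.
    move=> [s' t'] [/= hs ht] [/= /negP ni e']; case: ni.
    have -> : s' = t' + (s - t); last by rewrite addrAC subrr add0r.
    apply: Hr; first by rewrite distrC.
      by rewrite (_ : _ - s = t' - t) 1?distrC //; ring.
    by rewrite immersion_int // -e'.
  have [[a [as1 at0]] [b [as0 at1]]] := row_free_dual (gi_transverse fi e st).
  have q0 : 0 < (4^-1 : R) by rewrite invr_gt0.
  have [r1 r10 H1] := dot3_increment s a fi q0; have [r2 r20 H2] := dot3_increment t a fi q0.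
  have [r3 r30 H3] := dot3_increment s b fi q0; have [r4 r40 H4] := dot3_increment t b fi q0.
  exists (ball s r1 `&` ball s r3, ball t r2 `&` ball t r4).
    by split; apply: filterI; exact: nbhsx_ballx.
  move=> [s' t'] [/= [hs1 hs3] [ht2 ht4]] [/= _ est].
  have h1 := H1 (s' - s); have h2 := H2 (t' - t).
  have h3 := H3 (s' - s); have h4 := H4 (t' - t).
  rewrite /= !sub0r !opprB /= in h1 h2 h3 h4.
  move: h1 h2 h3 h4 => /(_ hs1) + /(_ ht2) + /(_ hs3) + /(_ ht4).
  rewrite !subrKC !dot3B as1 at0 as0 at1 est e !mulr0 !mulr1 !subr0.
  move: (dot3 a _ - dot3 a _) (dot3 b _ - dot3 b _) => u1 u2.
  have d1 := ler_normB u1 (u1 - (s' - s)); have d2 := ler_normB u2 (u2 - (t' - t)).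
  rewrite !subKr in d1 d2 => h1 h2 h3 h4.
  have [p00 q00] := zero _ _ _ _ _ _ (normr_ge0 _) (normr_ge0 _) d1 d2 h1 h2 h3 h4.
  by rewrite -[s'](subrK s) -[t'](subrK t) (normr0_eq0 p00) (normr0_eq0 q00) !add0r.
apply: sub_finite_set (finite_image fst KD) => s [us [t [st e]]].
pose k : R := (Num.floor (t - u))%:~R.
have kint : k \is a Num.int by exact: intr_int.
exists (s, t - k) => //; split; split => /=.
- by rewrite in_itv.
- have := floor_le (t - u); have := floorD1_gt (t - u); rewrite in_itv /= -/k intrD -/k.
  by move=> ? ?; apply/andP; split; lra.
- apply: contraNN st => h; have -> : s - t = s - (t - k) - k by ring.
  exact: rpredB.
- by rewrite e -[in LHS](subrK k t) immersion_int.
Qed.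
End DoublePoints.

(** * Double points do not depend on the parametrization *)

Section Crossings.
Context {R : realType}.
Implicit Types (a b x y : 'rV[R]_3) (f g : R -> 'rV[R]_3) (P : set 'rV[R]_3).

Lemma int_shift (u s : R) : exists2 k, k \is a Num.int & u <= s + k < u + 1.
Proof.
exists (- (Num.floor (s - u))%:~R); first by rewrite rpredN; exact: intr_int.
have := floor_le (s - u); have := floorD1_gt (s - u); rewrite intrD.
by move: (_%:~R) => k ? ?; apply/andP; split; lra.
Qed.

Lemma unit_notin_int (r : R) : 0 < r -> r < 1 -> r \isn't a Num.int.
Proof.
move=> r0 r1; apply/negP => /intrP[m rm]; move: r0 r1.
by rewrite rm ltr0z ltrz1 gtz0_ge1 => /le_lt_trans h /h; rewrite ltxx.
Qed.

Lemma double_pointsE f : double_points f = f @` double_param f.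
Proof.
apply/seteqP; split=> x.
  by case=> s [t [st fs ft]]; exists s => //; exists t; rewrite fs ft.
by case=> s [t [st e]] <-; exists s, t; rewrite e.
Qed.

Lemma finite_double_points f : generic_immersion f -> finite_set (double_points f).
Proof.
move=> fi; rewrite double_pointsE.
apply: sub_finite_set (finite_image f (finite_double_param 0 fi)) => _ [s [t [st e]] <-].
have [k kint /andP[k0 k1]] := int_shift 0 s.
exists (s + k); last by rewrite immersion_int.
split; first by rewrite k0 ltW.
exists t; split; last by rewrite immersion_int.
by apply: contraNN st => h; rewrite -[s](addrK k) addrAC rpredB.
Qed.

(** The rest of the period, [[t + r, t + 1 - r]], has a compact image that misses [f t], so the
    curve can come close to [f t] only through parameters close to [t] modulo 1. *)
Lemma immersion_near f t r : generic_immersion f -> ~ double_points f (f t) -> 0 < r ->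
  \forall y \near f t, range f y -> exists2 h, `|h| < r & y = f (t + h).
Proof.
move=> fi nd r0.
pose K := f @` `[t + r, t + 1 - r].
have cK : closed K.
  apply: compact_closed; first exact: norm_hausdorff.
  apply: continuous_compact; last exact: segment_compact.
  by apply: continuous_subspaceT; exact: immersion_continuous.
have nK : (~` K) (f t).
  move=> [s /=]; rewrite in_itv /= => /andP[s1 s2] e; apply: nd.
  exists s, t; split => //; apply: unit_notin_int; lra.
have : nbhs (f t) (~` K) by apply: open_nbhs_nbhs; split => //; exact: closed_openC.
apply: filterS => y nKy [s _ e].
have [k kint /andP[k0 k1]] := int_shift t s.
have {}e : f (s + k) = y by rewrite immersion_int.
have [h|h] := ltP (s + k) (t + r).
  by exists (s + k - t); [rewrite ger0_norm; lra | rewrite subrKC e].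
have [h'|h'] := ltP (t + 1 - r) (s + k).
  exists (s + k - 1 - t); first by rewrite ler0_norm; lra.
  by rewrite subrKC -e -(gi_periodic fi (s + k - 1)) subrK.
by case: nKy; exists (s + k) => //=; rewrite in_itv /= h h'.
Qed.

(* At a point that f passes only once, the range of f has a tangent line. *)
Lemma double_points_sub f g : generic_immersion f -> generic_immersion g ->
  range f = range g -> double_points g `<=` double_points f.
Proof.
move=> fi gi fg x [s1 [s2 [s12 gs1 gs2]]].
apply: contrapT => nd.
have [t _ ft] : range f x by rewrite fg; exists s1.
set v := derive1 f t.
have vv : 0 < dot3 v v by rewrite dot3_gt0 (gi_immersion fi).
(* The tangent line along [v]: forms killing [v] are negligible against [dot3 v]. Being stated for
   points of the common range, it applies to [g]. *)
have bound c e : dot3 c v = 0 -> 0 < e ->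
    \forall y \near x, range g y -> `|dot3 c (y - x)| <= e * `|dot3 v (y - x)|.
  move=> cv e0; rewrite -ft in nd *.
  have d1 : 0 < e * (dot3 v v / 2) by rewrite mulr_gt0 ?divr_gt0.
  have d2 : 0 < dot3 v v / 2 by rewrite divr_gt0.
  have [r1 /= r10 H1] := dot3_increment t c fi d1.
  have [r2 /= r20 H2] := dot3_increment t v fi d2.
  have r0 : 0 < Num.min r1 r2 by rewrite lt_min r10.
  have := immersion_near fi nd r0; apply: filterS => y + yg.
  rewrite fg => /(_ yg)[h]; rewrite lt_min => /andP[h1 h2] ->.
  have := H1 h; have := H2 h; rewrite /= sub0r normrN -/v cv mulr0 subr0.
  move=> /(_ h2) + /(_ h1).
  move: (dot3 v (f _ - _)) (dot3 c (f _ - _)) => q p hq hp.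
  have : `|h * dot3 v v| <= `|q| + dot3 v v / 2 * `|h|.
    rewrite -[h * _](subKr q); apply: (le_trans (ler_normB _ _)).
    by rewrite lerD2l.
  rewrite normrM (gtr0_norm vv) => hq'.
  apply: (le_trans hp); rewrite -mulrA ler_pM2l //.
  by move: (dot3 v v) (`|h|) (`|q|) vv hq' => D H Q ? ?; nra.
have aux (h p W d e : R) : 0 < h -> 0 < d -> d <= 1 -> d * (W + 2) <= e ->
    p <= d * (h * W + d * h) -> p + d * h <= h * e.
  move=> h0 d0 d1 d2 h4; rewrite -(ler_pM2l h0) in d2; apply: le_trans d2.
  apply: (@le_trans _ _ (d * (h * W + d * h) + d * h)); first by rewrite lerD2r.
  rewrite -subr_ge0.
  have -> : h * (d * (W + 2)) - (d * (h * W + d * h) + d * h) = h * (d * (1 - d)) by ring.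
  by apply: mulr_ge0; [exact: ltW | apply: mulr_ge0; [exact: ltW | rewrite subr_ge0]].
have par c s : g s = x -> dot3 c v = 0 -> dot3 c (derive1 g s) = 0.
  move=> gs cv; apply/eqP; rewrite -normr_le0; apply/ler_addgt0Pl => e e0; rewrite addr0.
  set W := `|dot3 v (derive1 g s)|.
  have W0 : 0 < W + 2 by apply: ltr_wpDl; [exact: normr_ge0 | ].
  (* With d <= 1 the accumulated error d (W + d) + d is at most d (W + 2) <= e. *)
  have e1 : 0 < Num.min 1 (e / (W + 2)) by rewrite lt_min ltr01 divr_gt0.
  set d := Num.min _ _ in e1.
  have := bound c d cv e1.
  have cg : (fun h => g (s + h)) @ (0 : R) --> x.
    rewrite -gs -[in g s](addr0 s).
    apply: (cvg_comp (fun h : R => s + h) g _ (immersion_continuous gi (x := s + 0))).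
    by apply: cvgD; [exact: cvg_cst | exact: cvg_id].
  move=> /cg [r /= r0 Hr].
  have [r1 /= r10 H1] := dot3_increment s c gi e1.
  have [r2 /= r20 H2] := dot3_increment s v gi e1.
  pose m := Num.min r (Num.min r1 r2).
  have m0 : 0 < m by rewrite !lt_min r0 r10.
  have h0 : 0 < m / 2 by rewrite divr_gt0.
  have hm : `|m / 2| < m by rewrite gtr0_norm; lra.
  move: hm; rewrite {2}/m !lt_min => /and3P[hr hr1 hr2].
  have := Hr (m / 2); have := H1 (m / 2); have := H2 (m / 2).
  rewrite /= sub0r normrN gs => /(_ hr2) + /(_ hr1) + /(_ hr (ex_intro2 _ _ _ I erefl)).
  rewrite (gtr0_norm h0); move: (dot3 v (g _ - _)) (dot3 c (g _ - _)) => q p hq hp hpq.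
  have h1 : `|m / 2 * dot3 v (derive1 g s)| <= `|q| + d * (m / 2).
    rewrite -[m / 2 * _ in X in X <= _](subKr q); apply: (le_trans (ler_normB _ _)).
    by rewrite lerD2l.
  have h2 : `|m / 2 * dot3 c (derive1 g s)| <= `|p| + d * (m / 2).
    rewrite -[m / 2 * _ in X in X <= _](subKr p); apply: (le_trans (ler_normB _ _)).
    by rewrite lerD2l.
  have h3 : `|q| <= m / 2 * W + d * (m / 2).
    rewrite -[q](subrK (m / 2 * dot3 v (derive1 g s))) addrC.
    apply: (le_trans (ler_normD _ _)); rewrite lerD //.
    by rewrite normrM (gtr0_norm h0).
  move: h2; rewrite normrM (gtr0_norm h0) => h2.
  have d1 : d <= 1 by rewrite /d ge_min lexx.
  have d2 : d * (W + 2) <= e by rewrite -ler_pdivlMr // /d ge_min lexx orbT.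
  have h4 : `|p| <= d * (m / 2 * W + d * (m / 2)).
    by apply: (le_trans hpq); rewrite ler_pM2l.
  rewrite -(ler_pM2l h0); apply: (le_trans h2).
  exact: (aux _ _ _ _ _ h0 e1 d1 d2 h4).
have [[a [a1 a2]] [b [b1 b2]]] := row_free_dual (gi_transverse gi (etrans gs1 (esym gs2)) s12).
have par1 c := par c s1 gs1; have par2 c := par c s2 gs2.
move: (derive1 g s1) (derive1 g s2) a1 a2 b1 b2 par1 par2 => w1 w2 a1 a2 b1 b2 par1 par2.
have comb k l z : dot3 (k *: a - l *: b) z = k * dot3 a z - l * dot3 b z.
  by rewrite dot3Dl dot3Nl !dot3Zl.
(* This combination kills [v], hence both velocities of [g], which forces [dot3 b v] and [dot3 a v]
   to vanish. Then [a] kills [v] too, so it kills [w1], against [a1]. *)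
have cv : dot3 (dot3 b v *: a - dot3 a v *: b) v = 0 by rewrite comb mulrC subrr.
have := par1 _ cv; have := par2 _ cv.
rewrite !comb a1 a2 b1 b2 !mulr0 !mulr1 subr0 sub0r => /eqP; rewrite oppr_eq0 => /eqP av bv.
by have := par1 _ av; rewrite a1 => /eqP; rewrite oner_eq0.
Qed.

Lemma crossingsE f P : parametrizes f P -> crossings P = double_points f.
Proof.
move=> [fi fP]; apply/seteqP; split=> x; last by exists f.
by move=> [g [gi gP]]; apply: double_points_sub => //; rewrite fP gP.
Qed.

Lemma C_eq0 f P : parametrizes f P -> C P = 0%N <-> double_points f = set0.
Proof.
move=> fP; rewrite -(crossingsE fP) /C /c.
have fin : finite_set (crossings P).
  by rewrite (crossingsE fP); apply: finite_double_points; case: fP.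
rewrite cardfs_eq0; split; last by move=> ->; rewrite fset_set0 eqxx.
by case: eqP => // /fset_set_set0 -> //.
Qed.


End Crossings.

(** * Removing two points from a closed curve *)

Section Isotopy.
Context {R : realType}.
Implicit Types (x y z : 'rV[R]_3) (f g : R -> 'rV[R]_3) (P Q : set 'rV[R]_3).

Lemma itv_avoids_finite (A : set R) (c d : R) : finite_set A -> c < d ->
  exists2 p, c < p < d & ~ A p.
Proof.
move=> fA cd; apply: contrapT => no; have dc : 0 < d - c by rewrite subr_gt0.
(* Denominators start at 2, since 1 would give the excluded end point [d]. *)
pose u (n : nat) : R := c + (d - c) / n.+2%:R.
have Au n : A (u n).
  apply: contrapT => nA; apply: no; exists (u n) => //.
  have n0 : 0 < n.+2%:R :> R by rewrite ltr0n.
  rewrite /u ltrDl divr_gt0 //= -ltrBrDl ltr_pdivrMr // ltr_pMr //.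
  by rewrite ltr1n.
apply: infinite_nat; apply: sub_finite_set (finite_preimage _ fA) => [n _|]; first exact: Au.
move=> n m _ _ /addrI /(mulfI (lt0r_neq0 dc)) /invr_inj /eqP.
by rewrite eqr_nat => /eqP [].
Qed.

(* Two points can be removed from a closed curve with a double point without
   disconnecting it, but not from a simple closed curve. *)
Lemma simple_closed_curve_range f g :
  continuous f -> continuous g ->
  (forall t, f (t + 1) = f t) -> (forall t, g (t + 1) = g t) ->
  range f = range g ->
  (forall s t, f s = f t -> s - t \is a Num.int) ->
  (forall u, finite_set [set s | u <= s <= u + 1 /\ double_param g s]) ->
  forall s t, g s = g t -> s - t \is a Num.int.
Proof.
move=> cf cg pf pg fg injf fin s0 t1 e0; apply: contrapT => /negP st1.
have [k kint /andP[k0 k1]] := int_shift s0 t1.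
have {}e0 : g s0 = g (t1 + k) by rewrite periodic_int.
have {k0 st1}k0 : s0 < t1 + k.
  rewrite lt_neqAle k0 andbT; apply: contraNneq st1 => ->.
  by rewrite addrAC subrr add0r.
move: (t1 + k) k0 k1 e0 => t0 st0 ts0 e0 {t1 k kint}.
(* The removed points are passed once by [g] and separate the two visits [s0], [t0] to the double
   point, so the two remaining pieces of [g] still meet there. *)
have [p /andP[p1 p2] np] := itv_avoids_finite (fin s0) st0.
have [q /andP[q1 q2] nq] := itv_avoids_finite (fin s0) ts0.
have {}np s : s - p \isn't a Num.int -> g s <> g p.
  move=> sp e; apply: np; split; first by apply/andP; split; lra.
  by exists s; split => //; rewrite -opprB rpredN.
have {}nq s : s - q \isn't a Num.int -> g s <> g q.
  move=> sp e; apply: nq; split; first by apply/andP; split; lra.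
  by exists s; split => //; rewrite -opprB rpredN.
have NI (r s : R) : r < s -> s < r + 1 -> s - r \isn't a Num.int.
  by move=> ? ?; apply: unit_notin_int; lra.
have NI' (r s : R) : r < s -> s < r + 1 -> r - s \isn't a Num.int.
  by move=> ? ?; rewrite -opprB rpredN NI.
pose X := range g `\` [set g p; g q].
have XE : X = g @` `]p, q[ `|` g @` `]q, p + 1[.
  apply/seteqP; split => x.
    move=> [[s _ <-] /not_orP[sp sq]].
    have [k kint /andP[k0 k1]] := int_shift p s.
    rewrite -(periodic_int s pg kint) /= in sp sq *; move: (s + k) k0 k1 sp sq => {}s k0 k1 sp sq.
    have ps : p < s by rewrite lt_neqAle k0 andbT; apply: contra_not_neq sp => ->.
    have qs : s != q by apply: contra_not_neq sq => ->.
    have [sq'|sq'|/eqP] := ltgtP s q; last by rewrite (negbTE qs).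
      by left; exists s => //=; rewrite in_itv /= ps.
    by right; exists s => //=; rewrite in_itv /= sq'.
  case=> -[s /=]; rewrite in_itv /= => /andP[s1 s2] <-; split; first by exists s.
  - by case=> /=; [apply: np; apply: NI; lra | apply: nq; apply: NI'; lra].
  - by exists s.
  - by case=> /=; [apply: np; apply: NI; lra | apply: nq; apply: NI; lra].
have cX : connected X.
  rewrite XE; apply: connectedU.
  - exists (g t0); split; first by exists t0 => //=; rewrite in_itv /= p2 q1.
    exists (s0 + 1); last by rewrite pg.
    by rewrite /= in_itv /=; apply/andP; split; lra.
  - apply: connected_continuous_connected; last exact: continuous_subspaceT.
    by apply/connected_intervalP; exact: interval_is_interval.
  - apply: connected_continuous_connected; last exact: continuous_subspaceT.
    by apply/connected_intervalP; exact: interval_is_interval.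
have cimg c d : closed (f @` `[c, d]).
  apply: compact_closed; first exact: norm_hausdorff.
  apply: continuous_compact; last exact: segment_compact.
  exact: continuous_subspaceT.
have [u _ fu] : range f (g p) by rewrite fg; exists p.
have [v [uv vu] fv] : exists2 v, u < v /\ v < u + 1 & f v = g q.
  have [v _ fv] : range f (g q) by rewrite fg; exists q.
  have [k kint /andP[k0 k1]] := int_shift u v.
  exists (v + k); last by rewrite periodic_int.
  split => //; rewrite lt_neqAle k0 andbT; apply/eqP => h.
  apply: (np q); first by apply: NI; lra.
  by rewrite -fv -fu [in RHS]h periodic_int.
have ninj r s : r < s -> s < r + 1 -> f r <> f s.
  by move=> rs sr /injf; apply/negP; exact: NI'.
pose B := f @` `]u, v[.
have inB s : u < s -> s < v -> X (f s).
  move=> us sv; split; first by rewrite -fg; exists s.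
  by rewrite -fu -fv; case=> /=; [move/esym | ]; apply: ninj; lra.
have inB' s : v < s -> s < u + 1 -> X (f s).
  move=> us sv; split; first by rewrite -fg; exists s.
  by rewrite -fu -fv; case=> /= /esym; apply: ninj; lra.
(* One open arc of the simple curve [f] is nonempty, open and closed in [X], both by compactness of
   closed arcs; yet it misses the other arc. *)
have BX : B = X.
  apply: cX.
  - exists (f ((u + v) / 2)); exists ((u + v) / 2) => //=.
    by rewrite in_itv /=; apply/andP; split; lra.
  - exists (~` (f @` `[v, u + 1])); first exact: closed_openC.
    apply/seteqP; split => x.
      move=> [s /=]; rewrite in_itv /= => /andP[s1 s2] <-; split; first exact: inB.
      move=> [r /=]; rewrite in_itv /= => /andP[r1 r2] /esym; apply: ninj; lra.
    move=> [[+ xpq] nx]; rewrite -fg => -[s _ sx].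
    have [k kint /andP[k0 k1]] := int_shift u s.
    rewrite -(periodic_int s pf kint) in sx; exists (s + k) => //=; rewrite in_itv /=.
    have -> /= : u < s + k.
      rewrite lt_neqAle k0 andbT; apply: contra_not_neq xpq => h.
      by left; rewrite -fu -sx -h.
    rewrite ltNge; apply/negP => h; apply: nx; exists (s + k) => //=.
    by rewrite in_itv /= h ltW.
  - exists (f @` `[u, v]); first exact: cimg.
    apply/seteqP; split => x.
      move=> [s /=]; rewrite in_itv /= => /andP[s1 s2] <-; split; first exact: inB.
      by exists s => //=; rewrite in_itv /= !ltW.
    move=> [[_ xpq] [s /=]]; rewrite in_itv /= => /andP[s1 s2] sx; exists s => //=.
    rewrite in_itv /= !lt_neqAle s1 s2 !andbT; apply/andP; split; apply: contra_not_neq xpq => h.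
      by left; rewrite -fu -sx -h.
    by right; rewrite /= -fv -sx -h.
have : B (f ((v + u + 1) / 2)) by rewrite BX; apply: inB'; lra.
by move=> -[s /=]; rewrite in_itv /= => /andP[s1 s2]; apply: ninj; lra.
Qed.

Lemma double_points_eq0 f :
  double_points f = set0 <-> forall s t, f s = f t -> s - t \is a Num.int.
Proof.
split => [e s t fst|inj]; last first.
  apply/seteqP; split=> // x [s [t [st fs ft]]].
  by move: st; rewrite inj // fs ft.
apply: contrapT => /negP st; have : double_points f (f s) by exists s, t.
by rewrite e.
Qed.

(** The final map is a smooth homeomorphism whose differential may be singular, so the image of an
    immersion under it need not be one and transversality cannot be transported. Only topology of
    the range is used. *)
Lemma C_isotopic P Q : knot_projection P -> knot_projection Q ->
  sphere_isotopic P Q -> C P = C Q.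
Proof.
move=> [f fP] [g gQ] [H [smH bijH _ HPQ]].
have [fi fP'] := fP; have [gi gQ'] := gQ.
pose h := fun x => H (1, x).
have [_ injH _] : set_bij sphere sphere h by apply: bijH; rewrite ler01 lexx.
have ch : continuous h.
  move=> x; have [cH _] := smH [::].
  apply: (@continuous_comp _ _ _ (fun x : 'rV[R]_3 => ((1 : R^o), x)) H); last exact: cH.
  move=> A [[U V] /= [U1 Vx] UV]; apply: (@filterS _ (nbhs x) _ _ _ _ Vx) => y Vy.
  by apply: (UV (_, y)); split => //=; exact: nbhs_singleton.
have chf : continuous (h \o f).
  by move=> t; apply: continuous_comp; [exact: immersion_continuous | exact: ch].
have phf t : (h \o f) (t + 1) = (h \o f) t by rewrite /= (gi_periodic fi).
have hfE s t : (h \o f) s = (h \o f) t -> f s = f t.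
  by move=> e; apply: injH; rewrite ?inE; try exact: (gi_sphere fi).
have rhf : range (h \o f) = range g by rewrite gQ' -HPQ -fP' image_comp.
have CE : C P = 0%N <-> C Q = 0%N.
  rewrite (C_eq0 fP) (C_eq0 gQ) !double_points_eq0; split => inj.
    apply: (simple_closed_curve_range chf (immersion_continuous gi) phf (gi_periodic gi) rhf).
      by move=> s t /hfE; exact: inj.
    by move=> u; exact: finite_double_param.
  move=> s t e.
  apply: (simple_closed_curve_range (immersion_continuous gi) chf (gi_periodic gi)
    phf (esym rhf) inj).
    move=> u; apply: sub_finite_set (finite_double_param u fi) => r [ur [r' [rr' /hfE e']]].
    by split => //; exists r'.
  by rewrite /= e.
move: CE; rewrite /C; case: ifP => _; case: ifP => _ // [h1 h2].
  by have := h1 erefl.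
by have := h2 erefl.
Qed.
End Isotopy.

(** * Stereographic projection *)

Lemma det2_neq0 (R : realType) (u v : R * R) :
  (forall k l, k * u.1 + l * v.1 = 0 -> k * u.2 + l * v.2 = 0 -> k = 0 /\ l = 0) ->
  det2 u v != 0.
Proof.
move=> ind; apply/eqP => d; rewrite /det2 in d.
have [||v2 u2] := ind v.2 (- u.2); [by rewrite -[RHS]d; ring | by ring |].
have [||v1 u1] := ind v.1 (- u.1); [by ring | by rewrite -[RHS]oppr0 -[in RHS]d; ring |].
have [||/eqP] := ind 1 0; last by rewrite oner_eq0.
  by move/eqP: u1; rewrite oppr_eq0 => /eqP ->; rewrite !(mulr0, mul0r) addr0.
by move/eqP: u2; rewrite oppr_eq0 => /eqP ->; rewrite !(mulr0, mul0r) addr0.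
Qed.

Section Stereographic.
Context {R : realType}.
Implicit Types (a x y z w p : 'rV[R]_3) (f : R -> 'rV[R]_3).

Lemma dot3_delta i z : dot3 (delta_mx 0 i) z = z 0 i.
Proof.
rewrite /dot3 (bigD1 i) //= big1 => [|j /negbTE ji]; rewrite mxE ?eqxx ?ji.
  by rewrite mul1r addr0.
by rewrite andbF mul0r.
Qed.

(** If coordinate [k] of [p] is nonzero, a vector orthogonal to [p] is determined by its two other
    coordinates. *)
Lemma complementary_coordinates p : p != 0 -> exists c1 c2, forall z,
  dot3 p z = 0 -> dot3 c1 z = 0 -> dot3 c2 z = 0 -> z = 0.
Proof.
move=> p0; have [k pk] : exists k, p 0 k != 0.
  apply: contrapT => h; move/eqP: p0; apply; apply/rowP => k; rewrite mxE.
  by apply/eqP; apply: contrapT => hk; apply: h; exists k; apply/negP.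
exists (delta_mx 0 (lift k 0)), (delta_mx 0 (lift k 1)) => z.
rewrite !dot3_delta => pz z1 z2.
have zl l : l != k -> z 0 l = 0.
  case: (unliftP k l) => [[[|[|//]] j2]|] -> lk; last by rewrite eqxx in lk.
    by rewrite -[RHS]z1; congr (z 0 (lift k _)); exact/val_inj.
  by rewrite -[RHS]z2; congr (z 0 (lift k _)); exact/val_inj.
move: pz; rewrite /dot3 (bigD1 k) //= big1 => [|l /zl ->]; last by rewrite mulr0.
rewrite addr0 => /eqP; rewrite mulf_eq0 (negbTE pk) /= => /eqP zk.
by apply/rowP => l; rewrite mxE; have [->|/zl] := eqVneq l k.
Qed.

Lemma sphere_dist x y : sphere x -> sphere y ->
  dot3 (x - y) (x - y) = 2 * (1 - dot3 x y).
Proof.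
move=> /sphereE xx /sphereE yy.
by rewrite dot3B !(dot3C (x - y)) !dot3B xx yy (dot3C y x); ring.
Qed.

Lemma sphere_dot_lt1 x y : sphere x -> sphere y -> x != y -> 0 < 1 - dot3 x y.
Proof.
move=> sx sy; rewrite -subr_eq0 -dot3_gt0 sphere_dist //.
by rewrite pmulr_rgt0.
Qed.

Lemma sphere_dot_le1 x y : sphere x -> sphere y -> dot3 x y <= 1.
Proof.
move=> sx sy; have [->|xy] := eqVneq x y; first by move/sphereE: sy => ->.
by rewrite -subr_ge0 ltW // sphere_dot_lt1.
Qed.

(** On the sphere [dot3 (f t) (f s)] is at most 1, with equality at [s = t]; a nonzero derivative
    there would exceed this bound on one side. *)
Lemma immersion_orthogonal f t : generic_immersion f -> dot3 (f t) (derive1 f t) = 0.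
Proof.
move=> fi; have S s := gi_sphere fi s; have ff := proj1 (sphereE _) (S t).
have le1 s := sphere_dot_le1 (S t) (S s).
have [h|h|//] := ltgtP (dot3 (f t) (derive1 f t)) 0.
  have : 0 < dot3 (- f t) (derive1 f t) by rewrite dot3Nl oppr_gt0.
  move=> /(immersion_tangent fi) /filter_ex[e [_]].
  by rewrite dot3Nl dot3B ff opprB subr_gt0 ltNge le1.
have /filter_ex[e [+ _]] := immersion_tangent fi h.
by rewrite dot3B ff subr_gt0 ltNge le1.
Qed.

(* Stereographic projection from p to the plane {z | dot3 p z = -1}, followed by
   two coordinates c1, c2 that are independent on that plane. *)
Definition proj c p x := dot3 c (x - p) / (1 - dot3 p x).
Definition proj2 c1 c2 p x : R * R := (proj c1 p x, proj c2 p x).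

Section Projection.
Context (p c1 c2 : 'rV[R]_3) (sp : sphere p)
  (coords : forall z, dot3 p z = 0 -> dot3 c1 z = 0 -> dot3 c2 z = 0 -> z = 0).
Notation S := (proj2 c1 c2 p).

(** Equal projections put [x] and [y] on one line through [p]; comparing squared distances to [p]
    gives [l * l = l] for the ratio, so it is 1. *)
Lemma proj2_inj x y : sphere x -> sphere y -> x != p -> y != p -> S x = S y -> x = y.
Proof.
move=> sx sy xp yp [e1 e2].
have px : 0 < 1 - dot3 p x by rewrite sphere_dot_lt1 // eq_sym.
have py : 0 < 1 - dot3 p y by rewrite sphere_dot_lt1 // eq_sym.
have pp := proj1 (sphereE _) sp.
have z0 : (1 - dot3 p x)^-1 *: (x - p) - (1 - dot3 p y)^-1 *: (y - p) = 0.
  apply: coords; rewrite dot3B !dot3Z.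
  - by rewrite !dot3B pp -[_ - 1]opprB -[dot3 p y - 1]opprB !mulrN !mulVf ?gt_eqF // subrr.
  - by rewrite ![_^-1 * _]mulrC -/(proj _ _ _) e1 subrr.
  - by rewrite ![_^-1 * _]mulrC -/(proj _ _ _) e2 subrr.
set l := (1 - dot3 p x) / (1 - dot3 p y).
have xy : x - p = l *: (y - p).
  move/eqP: z0; rewrite subr_eq0 => /eqP /(congr1 ( *:%R (1 - dot3 p x))).
  by rewrite !scalerA mulfV ?gt_eqF // scale1r.
have : dot3 (x - p) (x - p) = l * l * dot3 (y - p) (y - p) by rewrite {1}xy dot3Zl xy dot3Z mulrA.
rewrite !sphere_dist // !(dot3C _ p) => e.
have l1 : l = 1.
  have l0 : 0 < l by rewrite divr_gt0.
  have xl : 1 - dot3 p x = l * (1 - dot3 p y) by rewrite divfK ?gt_eqF.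
  rewrite xl in e.
  have : 2 * l * (1 - dot3 p y) * (l - 1) = 0 by nra.
  have pos : 0 < 2 * l * (1 - dot3 p y) by apply: mulr_gt0 => //; apply: mulr_gt0.
  by move=> /eqP; rewrite mulf_eq0 (gt_eqF pos) subr_eq0 => /eqP.
by move: xy; rewrite l1 scale1r => /(congr1 (+%R^~ p)); rewrite !subrK.
Qed.

(* dot2 n (S y - S x) * (1 - dot3 p y) is the linear form dot3 (pulled n x) in
   y - x; hence signs and directions can be computed without differentiating S. *)
Definition pulled n x := n.1 *: c1 + n.2 *: c2 + dot2 n (S x) *: p.

Lemma proj2_increment n x y : x != p -> y != p -> sphere x -> sphere y ->
  (0 < dot2 n (S y - S x)) = (0 < dot3 (pulled n x) (y - x)).
Proof.
move=> xp yp sx sy.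
have px : 0 < 1 - dot3 p x by rewrite sphere_dot_lt1 // eq_sym.
have py : 0 < 1 - dot3 p y by rewrite sphere_dot_lt1 // eq_sym.
rewrite -(pmulr_lgt0 _ py); congr (0 < _).
rewrite /pulled !dot3Dl !dot3Zl /dot2 /S /proj /= !dot3B.
move: (dot3 p x) (dot3 p y) px py => u v px py; field.
by rewrite !gt_eqF.
Qed.

(* (1 - dot3 p x) times the differential of S at x. *)
Definition dproj2 x w : R * R :=
  (dot3 c1 w + proj c1 p x * dot3 p w, dot3 c2 w + proj c2 p x * dot3 p w).

Lemma dot2_dproj2 n x w : dot2 n (dproj2 x w) = dot3 (pulled n x) w.
Proof. by rewrite /pulled !dot3Dl !dot3Zl /dot2 /=; ring. Qed.

Lemma dproj2_comb x k l w w' : dproj2 x (k *: w + l *: w') =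
  (k * (dproj2 x w).1 + l * (dproj2 x w').1, k * (dproj2 x w).2 + l * (dproj2 x w').2).
Proof.
rewrite /dproj2 !dot3D !dot3Z /=.
congr (_, _); move: (proj _ _ _) => m;
  by rewrite [in LHS]mulrDr !mulrDr addrACA ![m * (_ * _)]mulrCA.
Qed.

Lemma dproj2_inj x w : sphere x -> x != p -> dot3 x w = 0 -> dproj2 x w = 0 -> w = 0.
Proof.
move=> sx xp xw [e1 e2].
have px : 0 < 1 - dot3 p x by rewrite sphere_dot_lt1 // eq_sym.
have pp := proj1 (sphereE _) sp; have xx := proj1 (sphereE _) sx.
(* This vector is orthogonal to [p], and its coordinates [c1], [c2] are those of [dproj2 x w] up to
   the factor [1 - dot3 p x]. *)
have z0 : (1 - dot3 p x) *: w + dot3 p w *: (x - p) = 0.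
  have cz c : dot3 c w + proj c p x * dot3 p w = 0 ->
      dot3 c ((1 - dot3 p x) *: w + dot3 p w *: (x - p)) = 0.
    move=> e; rewrite dot3D !dot3Z -[RHS](mulr0 (1 - dot3 p x)) -e /proj.
    by move: px; move: (1 - _) => u u0; field; rewrite gt_eqF.
  by apply: coords; [rewrite dot3D !dot3Z dot3B pp; ring | exact: cz | exact: cz].
have pw : dot3 p w = 0.
  have := congr1 (dot3 x) z0; rewrite dot30 dot3D !dot3Z dot3B xw xx mulr0 add0r (dot3C x p).
  by move=> /eqP; rewrite mulf_eq0 (gt_eqF px) orbF => /eqP.
by move: z0; rewrite pw scale0r addr0 => /eqP; rewrite scaler_eq0 gt_eqF //= => /eqP.
Qed.

Context (f : R -> 'rV[R]_3) (fi : generic_immersion f) (fp : forall t, f t != p).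

Lemma proj2_continuous : continuous (S \o f).
Proof.
have cf a : continuous (fun t => dot3 a (f t)).
  by move=> t; exact: (cvg_comp _ _ (immersion_continuous fi (x := t)) (@dot3_continuous _ _ _)).
have cp c : continuous (fun t => proj c p (f t)).
  move=> t; apply: cvgM.
    rewrite (_ : (fun _ => _) = fun t => dot3 c (f t) - dot3 c p); last first.
      by apply/funext => s; rewrite dot3B.
    by rewrite dot3B; apply: cvgB; [exact: cf | exact: cvg_cst].
  apply: cvgV; last by apply: cvgB; [exact: cvg_cst | exact: cf].
  rewrite gt_eqF // sphere_dot_lt1 //; first exact: (gi_sphere fi).
  by rewrite eq_sym.
by move=> t; exact: (cvg_pair (cp c1 t) (cp c2 t)).
Qed.

Lemma proj2_tangent t : tangent (S \o f) t (dproj2 (f t) (derive1 f t)).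
Proof.
move=> n; rewrite dot2_dproj2 => /(immersion_tangent fi); apply: filterS => h [h1 h2].
have Sf s := gi_sphere fi s; split; first by rewrite proj2_increment.
rewrite -opprB dot2N -dot2Nl proj2_increment //.
rewrite (_ : pulled _ _ = - pulled n (f t)); first by rewrite dot3Nl -dot3N opprB.
by rewrite /pulled dot2Nl /= !scaleNr !opprD.
Qed.

Lemma proj2_transverse s t : f s = f t -> s - t \isn't a Num.int ->
  det2 (dproj2 (f s) (derive1 f s)) (dproj2 (f t) (derive1 f t)) != 0.
Proof.
move=> e st; have [[a [a1 a2]] [b [b1 b2]]] := row_free_dual (gi_transverse fi e st).
have := immersion_orthogonal s fi; have := immersion_orthogonal t fi; rewrite -e.
move: (derive1 f s) (derive1 f t) a1 a2 b1 b2 => ws wt a1 a2 b1 b2 xt xs.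
apply: det2_neq0 => k l e1 e2; have w0 : k *: ws + l *: wt = 0.
  apply: (dproj2_inj (gi_sphere fi s) (fp s)).
    by rewrite dot3D !dot3Z xs xt !mulr0 addr0.
  by rewrite dproj2_comb e1 e2.
have := congr1 (dot3 a) w0; have := congr1 (dot3 b) w0.
by rewrite !dot30 !dot3D !dot3Z a1 a2 b1 b2 !mulr0 !mulr1 addr0 add0r.
Qed.

End Projection.

End Stereographic.

(** * The moves *)

Section Moves.
Context {R : realType}.
Implicit Types (f : R -> 'rV[R]_3) (P Q : set 'rV[R]_3).

(** The pole [p] is off the curve, so all of it is projected. The parameter [p1 + 1] repeats the
    position and velocity of [p1], which provides the common tangent [u] at both ends of the
    period. *)
Lemma no_interlaced_immersion f p (p1 p2 p3 p4 : R) :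
  generic_immersion f -> sphere p -> ~ range f p ->
  p1 < p2 -> p2 < p3 -> p3 < p4 -> p4 < p1 + 1 ->
  f p1 = f p3 -> f p2 = f p4 ->
  (forall s t, p1 <= s <= p3 -> p3 <= t <= p1 + 1 -> f s = f t ->
    (s = p2 /\ t = p4) \/ ((s = p1 \/ s = p3) /\ (t = p3 \/ t = p1 + 1))) ->
  False.
Proof.
move=> fi sp pf p12 p23 p34 p45 f13 f24 inj.
have fp t : f t != p by apply/eqP => e; apply: pf; exists t.
have p0 : p != 0.
  apply/eqP => p0; move/sphereE: sp => /eqP.
  by rewrite p0 dot30 eq_sym oner_eq0.
have [c1 [c2 coords]] := complementary_coordinates p0.
have per := gi_periodic fi.
have d1 : derive1 f (p1 + 1) = derive1 f p1.
  rewrite /derive1 (_ : (fun h => _) = fun h => h^-1 *: (f (h + p1) - f p1)) //.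
  by apply/funext => h; rewrite addrA !per.
have tan t := @proj2_tangent _ p c1 c2 sp f fi fp t.
have ni (r s : R) : r < s -> s < r + 1 -> r - s \isn't a Num.int.
  by move=> ? ?; rewrite -opprB rpredN; apply: unit_notin_int; lra.
have t5 := tan (p1 + 1); rewrite d1 per in t5.
apply: (no_interlaced_curve p12 p23 p34 p45 (proj2_continuous sp fi fp)
  _ _ _ (tan p1) t5 (tan p3) (tan p2) (tan p4)).
- by rewrite /= f13.
- by rewrite /= per f13.
- by rewrite /= f24.
- by apply: (proj2_transverse sp coords fi fp f13); apply: ni; lra.
- by apply: (proj2_transverse sp coords fi fp f24); apply: ni; lra.
- move=> s t hs ht /(proj2_inj sp coords (gi_sphere fi s) (gi_sphere fi t) (fp s) (fp t)).
  exact: inj.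
Qed.

Lemma int_lt1_eq (s t : R) : s - t \is a Num.int -> - 1 < s - t -> s - t < 1 -> s = t.
Proof.
move=> st h1 h2; have [h|h|//] := ltgtP s t.
  by move: st; rewrite -opprB rpredN; apply/contraTeq => _; apply: unit_notin_int; lra.
by move: st; apply/contraTeq => _; apply: unit_notin_int; lra.
Qed.

Lemma ord2 (i : 'I_2) : i = 0 \/ i = 1.
Proof. by case: i => [[|[|//]] hi]; [left | right]; exact/val_inj. Qed.

Lemma card_eq2_mem (T : choiceType) (A : set T) (x y z : T) :
  (A #= `I_2)%card -> A x -> A y -> x <> y -> A z -> z = x \/ z = y.
Proof.
move=> A2 Ax Ay /eqP xy Az.
have fA : finite_set A by exists 2%N.
have xyA : ([fset x; y] `<=` fset_set A)%fset.
  by apply/fsubsetP => w; rewrite !inE in_fset_set // => /orP[]/eqP ->; rewrite inE.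
have cxy : #|` [fset x; y]%fset| = #|` fset_set A|.
  by rewrite (card_fset_set A2) cardfs2 xy.
have : z \in [fset x; y]%fset.
  by rewrite (fsubset_cardP cxy xyA) in_fset_set // inE.
by rewrite !inE => /orP[]/eqP ->; [left | right].
Qed.

(* With f simple, f' would have exactly two double points, visited in the
   interlaced order P1 P2 Q1 Q2. *)
Lemma incoherent_bigon_false f f' psi (a b : 'I_2 -> R) (P1 P2 Q1 Q2 : R) p :
  generic_immersion f -> generic_immersion f' ->
  local_replacement f f' psi a b -> cross_pairwise f' a b 2 ->
  (forall s t, f s = f t -> s - t \is a Num.int) ->
  sphere p -> ~ range f' p ->
  a 0 <= P1 -> P1 < P2 -> P2 <= b 0 -> a 1 <= Q1 -> Q1 < Q2 -> Q2 <= b 1 ->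
  f' P1 = f' Q1 -> f' P2 = f' Q2 -> False.
Proof.
move=> fi fi' [_ [_ _ diskf _ _] [_ disj disk' simp _] out _] cross inj sp pf'.
move=> aP P12 Pb aQ Q12 Qb e1 e2.
(* Shifting the second arc by [k] puts its start in the period beginning at [a 0]; disjointness
   modulo 1 then orders the arcs as [b 0 < a 1 + k] and [b 1 + k < a 0 + 1]. *)
have [k kint /andP[k0 k1]] := int_shift (a 0) (a 1).
have I0 s : P1 <= s <= P2 -> s \in `[a 0, b 0] by rewrite in_itv /=; lra.
have I1 s : Q1 <= s <= Q2 -> s \in `[a 1, b 1] by rewrite in_itv /=; lra.
have h1 : b 0 < a 1 + k.
  rewrite ltNge; apply/negP => h.
  have [|||i01 _] := disj 0 1 (a 1 + k) (a 1).
  - by rewrite in_itv /= k0.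
  - by rewrite in_itv /=; lra.
  - by rewrite addrAC subrr add0r.
  - by [].
have h2 : b 1 + k < a 0 + 1.
  rewrite ltNge; apply/negP => h.
  have [|||i01 _] := disj 1 0 (a 0 + 1 - k) (a 0).
  - by rewrite in_itv /=; lra.
  - by rewrite in_itv /=; lra.
  - by rewrite (_ : _ - _ = 1 - k) ?rpredB ?rpred1 //; ring.
  - by [].
have per t l : l \is a Num.int -> f' (t + l) = f' t by exact: immersion_int.
have P12' : f' P1 <> f' P2.
  by move=> e; have := simp 0 P1 P2; rewrite !inE => /(_ (I0 _ _) (I0 _ _) e); lra.
have only (z : 'rV[R]_3) i j : i != j -> arc f' a b i z -> arc f' a b j z -> z = f' P1 \/ z = f' P2.
  have pt u v : u \in `[a 0, b 0] -> v \in `[a 1, b 1] -> f' u = f' v ->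
      (arc f' a b 0 `&` arc f' a b 1) (f' u).
    by move=> hu hv e; split; [exists u | exists v].
  have two (y : 'rV[R]_3) : arc f' a b 0 y -> arc f' a b 1 y -> y = f' P1 \/ y = f' P2.
    move=> y0 y1; apply: (@card_eq2_mem _ (arc f' a b 0 `&` arc f' a b 1)) => //.
    + exact: cross.
    + by apply: (pt _ Q1) => //; [apply: I0 | apply: I1]; lra.
    + by apply: (pt _ Q2) => //; [apply: I0 | apply: I1]; lra.
  move=> ij zi zj; case: (ord2 i) (ord2 j) ij zi zj => -> [] -> // _ zi zj; exact: two.
have at0 u m : f' u = f' P1 \/ f' u = f' P2 -> u + m \in `[a 0, b 0] -> m \is a Num.int ->
    (f' u = f' P1 /\ u + m = P1) \/ (f' u = f' P2 /\ u + m = P2).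
  move=> [] e hu mi; [left | right]; split=> //; apply: (simp 0); rewrite ?inE ?per //;
    by [exact: hu | apply: I0; lra].
have at1 u m : f' u = f' P1 \/ f' u = f' P2 -> u + m \in `[a 1, b 1] -> m \is a Num.int ->
    (f' u = f' P1 /\ u + m = Q1) \/ (f' u = f' P2 /\ u + m = Q2).
  move=> [] e hu mi; [left | right]; split=> //; apply: (simp 1); rewrite ?inE ?per -?e1 -?e2 //;
    by [exact: hu | apply: I1; lra].
apply: (@no_interlaced_immersion f' p P1 P2 (Q1 + k) (Q2 + k)) => //; rewrite ?per //; try lra.
move=> s t hs ht e.
have [st|st] := boolP (s - t \is a Num.int).
  right; have [h|h] := eqVneq s P1; last first.
    have {}h : P1 < s by rewrite lt_def h; lra.
    by have := int_lt1_eq st; lra.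
  have [h'|h'] := eqVneq t (P1 + 1); first by split; [left | right].
  have {}h' : t < P1 + 1 by rewrite lt_def eq_sym h'; lra.
  by have := int_lt1_eq st; lra.
(* A double point of [f'] outside the disk would be one of [f], which is simple; so it lies on the
   replaced arcs. *)
have inD u : f' u = f' s -> exists i m,
    [/\ u + m \in `[a i, b i], m \is a Num.int & arc f' a b i (f' s)].
  move=> us; suff : (psi @` cdisk) (f' u).
    move=> /disk' [i [m hm]]; exists i, m%:~R; split; [exact: hm | exact: intr_int |].
    by exists (u + m%:~R); [exact: hm | rewrite per //; exact: intr_int].
  apply: contrapT; rewrite us => nD; move/negP: st; apply; apply: inj.
  have ff v : f' v = f' s -> f' v = f v.
    move=> vs; apply: out => /diskf /disk'; rewrite vs; exact: nD.
  by rewrite -!ff.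
have [i [m [him mi ai]]] := inD s erefl; have [j [l [hjl li aj]]] := inD t (esym e).
have [ij|ij] := eqVneq i j.
  subst j; have : s + m = t + l.
    by apply: (simp i); rewrite ?inE ?per.
  move=> h; move: st; rewrite (_ : s - t = l - m) ?rpredB //.
  by rewrite -[s](addrK m) h; ring.
have vs := only _ _ _ ij ai aj; have vt := vs; rewrite e in vt.
case: (ord2 i) (ord2 j) ij him hjl => -> [] -> // _ him hjl.
  have [[es hs1]|[es hs1]] := at0 _ _ vs him mi; have [[et ht1]|[et ht1]] := at1 _ _ vt hjl li;
    try by case: P12'; rewrite -?es -?et.
  - right; split; [left | left].
      apply: int_lt1_eq; [|lra|lra]; rewrite -hs1.
      by rewrite opprD addrA subrr add0r rpredN.
    apply: int_lt1_eq; [|lra|lra]; rewrite -ht1.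
    by rewrite (_ : _ - _ = - l - k) ?rpredB ?rpredN ?rpred1 //; ring.
  - left; split.
      apply: int_lt1_eq; [|lra|lra]; rewrite -hs1.
      by rewrite opprD addrA subrr add0r rpredN.
    apply: int_lt1_eq; [|lra|lra]; rewrite -ht1.
    by rewrite (_ : _ - _ = - l - k) ?rpredB ?rpredN ?rpred1 //; ring.
(* Here the first loop reaches the second arc, possible only at its end [Q1 + k]; [Q2 + k] lies
   beyond it. *)
have [[es hs1]|[es hs1]] := at1 _ _ vs him mi; have [[et ht1]|[et ht1]] := at0 _ _ vt hjl li;
  try by case: P12'; rewrite -?es -?et.
- right; split; [right | right].
    apply: int_lt1_eq; [|lra|lra]; rewrite -hs1.
    by rewrite (_ : _ - _ = - m - k) ?rpredB ?rpredN ?rpred1 //; ring.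
  apply: int_lt1_eq; [|lra|lra]; rewrite -ht1.
  by rewrite (_ : _ - _ = - l - 1) ?rpredB ?rpredN ?rpred1 //; ring.
- have : s = Q2 + k; last by lra.
  apply: int_lt1_eq; [|lra|lra]; rewrite -hs1.
  by rewrite (_ : _ - _ = - m - k) ?rpredB ?rpredN ?rpred1 //; ring.
Qed.

End Moves.

(** * Invariance of [C] under each move *)

Section Final.
Context {R : realType}.
Implicit Types (f : R -> 'rV[R]_3) (P Q : set 'rV[R]_3).

Lemma C_eq1 f P : parametrizes f P -> double_points f !=set0 -> C P = 1%N.
Proof.
move=> fP /set0P/eqP f0; have := C_eq0 fP.
by rewrite /C; case: ifP => // _ [/(_ erefl)].
Qed.

Lemma turn1 : turn 1 = turn 0 :> R * R.
Proof. by rewrite /turn mul1r mul0r mul0rn cos2pi sin2pi cos0 sin0. Qed.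

Lemma weak_RII_creation_C P P' : weak_RII_creation P P' -> C P = C P'.
Proof.
move=> [f [f' [psi [a [b [fP fP' loc _ [cross [x [y [ngon ncoh]]]]]]]]]].
(* The base point [p] of the bigon lies off the curve and will be the pole of the projection. *)
have [U [phi [[_ [p [sp pf'] _] _ _ sides] _ inab]]] := ngon.
have [fi _] := fP; have [fi' _] := fP'.
have vx (i : 'I_2) : phi (turn (i%:R / 2)) = f' (x i).
  have [_ /(_ 0)] := sides i; rewrite addr0 => ->; last by rewrite lexx ler01.
  by rewrite subr0 mul1r mul0r addr0.
have vy (i : 'I_2) : phi (turn (i.+1%:R / 2)) = f' (y i).
  have [_ /(_ 1)] := sides i; rewrite natr1 => ->; last by rewrite lexx ler01.
  by rewrite subrr mul0r mul1r add0r.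
have y0x1 : f' (y 0) = f' (x 1) by rewrite -vx -vy.
have y1x0 : f' (y 1) = f' (x 0).
  by rewrite -vx -vy divff ?pnatr_eq0 // turn1 mul0r.
have xy i : x i < y i \/ y i < x i.
  by have [[[h _]|[h _]] _] := sides i; [left | right].
have [d _] := sides 0.
rewrite (C_eq1 fP'); last first.
  by case: d => -[_ d1 _ _]; [exists (f' (x 0)) | exists (f' (y 0))].
apply: (C_eq1 fP); apply: contrapT => nd.
have inj : forall s t, f s = f t -> s - t \is a Num.int.
  by apply/double_points_eq0; apply: contrapT => /eqP/set0P.
have inI i : (a i <= x i <= b i) /\ (a i <= y i <= b i).
  by have [] := inab i; rewrite !in_itv.
have [[/andP[? ?] /andP[? ?]] [/andP[? ?] /andP[? ?]]] := (inI 0, inI 1).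
have key := incoherent_bigon_false fi fi' loc cross inj sp pf'.
(* If the signs differ, the parameter intervals with ends [x 0], [y 0] and [y 1], [x 1] are both
   traversed between the vertices in the same sense, as [y0x1] and [y1x0] show. *)
case: (xy 0) (xy 1) => h0 [] h1.
- by apply: ncoh; left => i; case: (ord2 i) => ->.
- exact: (key (x 0) (y 0) (y 1) (x 1)).
- exact: (key (y 0) (x 0) (x 1) (y 1)).
- by apply: ncoh; right => i; case: (ord2 i) => ->.
Qed.

Lemma RIII_double_points f psi (a b : 'I_3 -> R) :
  simple_arcs f psi a b -> cross_pairwise f a b 1 -> double_points f !=set0.
Proof.
move=> [_ disj _ _ _] /(_ ord0 ord_max isT) cross.
have [x [[s hs fs] [t ht ft]] _] := eq_cardSP _ _ cross.
exists x, s, t; split => //; apply/negP => st.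
by have [] := disj _ _ _ _ hs ht st.
Qed.

Lemma RIII_with_C type P P' : @RIII_with R type P P' -> C P = C P'.
Proof.
move=> [f [f' [psi [a [b [fP fP' [_ sf sf' _ _] [c1 c2] _]]]]]].
by rewrite (C_eq1 fP (RIII_double_points sf c1)) (C_eq1 fP' (RIII_double_points sf' c2)).
Qed.

Lemma up_to_isotopy_C (move : set 'rV[R]_3 -> set 'rV[R]_3 -> Prop) P P' :
  (forall Q Q', move Q Q' -> [/\ knot_projection Q, knot_projection Q' & C Q = C Q']) ->
  knot_projection P -> knot_projection P' -> up_to_isotopy move P P' -> C P = C P'.
Proof.
move=> moveC kP kP' [Q [Q' [PQ /moveC[kQ kQ' QQ'] QP']]].
by rewrite (C_isotopic kP kQ PQ) QQ' (C_isotopic kQ' kP' QP').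
Qed.
End Final.

Theorem theorem3 (R : realType) (P P' : set 'rV[R]_3)
  (hP : knot_projection P) (hP' : knot_projection P')
  (hmove : up_to_isotopy weak_RII P P' \/ up_to_isotopy weak_RIII P P' \/
           up_to_isotopy strong_RIII P P') :
  C P = C P'.
Proof.
have RII (Q Q' : set 'rV[R]_3) : weak_RII_creation Q Q' ->
    [/\ knot_projection Q, knot_projection Q' & C Q = C Q'].
  move=> m; split; last exact: weak_RII_creation_C.
    by case: m => [f [f' [psi [a [b [fQ _ _ _ _]]]]]]; exists f.
  by case: m => [f [f' [psi [a [b [_ fQ _ _ _]]]]]]; exists f'.
have RIII type (Q Q' : set 'rV[R]_3) : RIII_with type Q Q' ->
    [/\ knot_projection Q, knot_projection Q' & C Q = C Q'].
  move=> m; split; last exact: RIII_with_C m.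
    by case: m => [f [f' [psi [a [b [fQ _ _ _ _]]]]]]; exists f.
  by case: m => [f [f' [psi [a [b [_ fQ _ _ _]]]]]]; exists f'.
by case: hmove => [|[]]; apply: up_to_isotopy_C => // Q Q' [] m;
  by [exact: RII | exact: RIII m | have [] := RII _ _ m | have [] := RIII _ _ _ m].
Qed.
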